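(* Fix a prime $p$ and integers $d,n\ge2$. Let $F$ be the free group on $d$ generators, with lower $p$-series $(F_i)_{i\ge1}$, and define the following sets: - $\mathcal{A}_{d,n}$ = the set of normal subgroups of $F/F_{n+1}$ lying in $F_2/F_{n+1}$; - $\mathcal{B}_{d,n}$ = the set of normal subgroups of $F/F_{n+1}$ lying in $F_2/F_{n+1}$ and not containing $F_n/F_{n+1}$; - $\mathcal{C}_{d,n}$ = the set of normal subgroups of $F/F_{n+1}$ lying in $F_n/F_{n+1}$; - $\mathfrak{A}_{d,n}$, $\mathfrak{B}_{d,n}$, $\mathfrak{C}_{d,n}$ = the sets of $\mathrm{Aut}(F/F_{n+1})$-orbits in $\mathcal{A}_{d,n}$, $\mathcal{B}_{d,n}$, $\mathcal{C}_{d,n}$ respectively; - $\mathfrak{D}_{d,n}$ = the set of regular $\mathrm{GL}(d,\mathbb{F}_p)$-orbits in $\mathcal{C}_{d,n}$. Then the $\mathrm{Aut}(F/F_{n+1})$-orbits in $\mathcal{C}_{d,n}$ coincide with the $\mathrm{GL}(d,\mathbb{F}_p)$-orbits in $\mathcal{C}_{d,n}$. There is a well-defined map $\pi_{d,n}$ from $\mathfrak{A}_{d,n}$ to the set of (isomorphism classes of) finite $p$-groups, sending the orbit of $L/F_{n+1}\in\mathcal{A}_{d,n}$ to $F/L$. Furthermore, $\pi_{d,n}$ induces bijections - between $\mathfrak{A}_{d,n}$ and the set of $p$-groups of lower $p$-length at most $n$ and minimally generated by $d$ elements; - between $\mathfrak{B}_{d,n}$ and the set of $p$-groups of lower $p$-length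 $n$ and minimally generated by $d$ elements; - between $\mathfrak{D}_{d,n}$ and the set of groups $H$ in $\pi_{d,n}(\mathfrak{C}_{d,n})$ with $A(H)=1$.
   Context: For a prime $p$ and a group $H$, the lower $p$-series $H=H_1\ge H_2\ge\cdots$ is defined by $H_{i+1}=H_i^p[H_i,H]$, where $H_i^p$ is the subgroup generated by the $p$-th powers of elements of $H_i$. $H$ has lower $p$-length $n$ if $H_n$ is the last non-identity term of this series. ''Minimally generated by $d$ elements'' means the smallest size of a generating set is $d$. Sets of $p$-groups are sets of isomorphism classes of finite $p$-groups. For a finite $p$-group $H$, $H_2=\Phi(H)$ is the Frattini subgroup and $A(H)$ denotes the group of automorphisms of $H/\Phi(H)$ induced by $\mathrm{Aut}(H)$. The natural map $\mathrm{Aut}(F/F_{n+1})\to\mathrm{Aut}(F/F_2)\cong\mathrm{GL}(d,\mathbb{F}_p)$ is surjective and its kernel acts trivially on $F_n/F_{n+1}$; hence $\mathrm{GL}(d,\mathbb{F}_p)$ acts on $F_n/F_{n+1}$ and on its subgroups, which gives the $\mathrm{GL}(d,\mathbb{F}_p)$-action on $\mathcal{C}_{d,n}$ (the set $\mathcal{C}_{d,n}$ is the set of all subspaces of the $\mathbb{F}_p$-vector space $F_n/F_{n+1}$, which is central in $F/F_{n+1}$). A regular orbit is one in which every point has trivial stabilizer. *)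

(* Defs.v *)
From HB Require Import structures.
From mathcomp Require Import all_boot all_order all_algebra.
From mathcomp Require Import all_fingroup all_solvable.
From mathcomp Require Import boolp classical_sets functions cardinality.

Set Implicit Arguments.
Unset Strict Implicit.
Unset Printing Implicit Defensive.

Local Open Scope classical_set_scope.
Local Open Scope card_scope.
Local Open Scope quotient_scope.
Local Open Scope group_scope.

(* The free group is infinite, so everything below lives in [groupType]; a
   [finGroupType] coerces to it. Subgroups are Prop-valued sets. *)

Definition hom (G H : groupType) (f : G -> H) : Prop :=
  {morph f : x y / x * y}.

Definition iso (G H : groupType) (f : G -> H) : Prop := hom f /\ bijective f.

Definition isomorphic (G H : groupType) : Prop := exists f : G -> H, iso f.

Definition aut (G : groupType) (f : G -> G) : Prop := iso f.

Definition free_basis (I : Type) (F : groupType) (x : I -> F) : Prop :=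
  forall (G : groupType) (y : I -> G),
    exists! f : F -> G, hom f /\ forall i, f (x i) = y i.

Definition subgroup (G : groupType) (K : set G) : Prop :=
  [/\ K 1, forall x y, K x -> K y -> K (x * y) & forall x, K x -> K x^-1].

Definition normal_subgroup (G : groupType) (K : set G) : Prop :=
  subgroup K /\ forall x y, K x -> K (x ^ y).

Definition gen (G : groupType) (S : set G) : set G := smallest (@subgroup G) S.

Record nsubgroup (G : groupType) := NSubgroup {
  nsub_set :> set G;
  nsubP : normal_subgroup nsub_set }.

Lemma nsub_inj (G : groupType) (M N : nsubgroup G) :
  M = N :> set G -> M = N.
Proof.
case: M N => [M MP] [N NP] /= eMN; case: _ / eMN NP => NP.
by rewrite (Prop_irrelevance MP NP).
Qed.

Definition pow_gen (G : groupType) (p : nat) (K : set G) : set G :=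
  gen [set x ^+ p | x in K].

(* [K, G] *)
Definition comm_gen (G : groupType) (K : set G) : set G :=
  gen [set z | exists2 x, K x & exists y, z = [~ x, y]].

Definition mulset (G : groupType) (A B : set G) : set G :=
  [set z | exists2 a, A a & exists2 b, B b & z = a * b].

Lemma gen_subgroup (G : groupType) (S : set G) : subgroup (gen S).
Proof.
split=> [K [[]]//|x y gx gy K KS|x gx K KS]; have [[_ KM KV] _] := KS.
- by apply: KM; [apply: gx|apply: gy].
- by apply: KV; apply: gx.
Qed.

Lemma gen_normal (G : groupType) (S : set G) :
  (forall x y, S x -> S (x ^ y)) -> normal_subgroup (gen S).
Proof.
move=> SJ; split=> [|x y gx K [[K1 KM KV] SK]]; first exact: gen_subgroup.
apply: (gx [set z | K (z ^ y)]); split=> [|z /(SJ z y)/SK//].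
split=> [|u v|u] /=; first by rewrite conj1g.
  by rewrite conjMg; apply: KM.
by rewrite conjVg; apply: KV.
Qed.

Lemma pow_gen_normal (G : groupType) (p : nat) (N : nsubgroup G) :
  normal_subgroup (pow_gen p N).
Proof.
apply: gen_normal => _ y [x Nx <-]; exists (x ^ y); last by rewrite conjXg.
by have [_] := nsubP N; apply.
Qed.

Lemma comm_gen_normal (G : groupType) (N : nsubgroup G) :
  normal_subgroup (comm_gen N).
Proof.
apply: gen_normal => _ y [x Nx [z ->]]; exists (x ^ y).
  by have [_] := nsubP N; apply.
by exists (z ^ y); rewrite conjRg.
Qed.

Lemma mulset_normal (G : groupType) (M N : set G) :
  normal_subgroup M -> normal_subgroup N -> normal_subgroup (mulset M N).
Proof.
move=> [[M1 MM MV] MJ] [[N1 NM NV] NJ]; split; first split.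
- by exists 1 => //; exists 1 => //; rewrite mulg1.
- move=> _ _ [a Ma [b Nb ->]] [c Mc [e Ne ->]].
  exists (a * c); first exact: MM.
  exists (b ^ c * e); first by apply: NM => //; apply: NJ.
  by rewrite /conjg !mulgA mulgK.
- move=> _ [a Ma [b Nb ->]]; exists a^-1; first exact: MV.
  exists (b^-1 ^ a^-1); first by apply: NJ; apply: NV.
  by rewrite invgM /conjg invgK !mulgA mulVg mul1g.
- move=> _ y [a Ma [b Nb ->]]; exists (a ^ y); first exact: MJ.
  by exists (b ^ y); [apply: NJ|rewrite conjMg].
Qed.

Lemma setT_normal (G : groupType) : normal_subgroup [set: G].
Proof. by []. Qed.

Definition whole (G : groupType) : nsubgroup G := NSubgroup (setT_normal G).

(* K |-> K^p [K, G] *)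
Definition pseries_step (G : groupType) (p : nat) (K : nsubgroup G) :
    nsubgroup G :=
  NSubgroup (mulset_normal (pow_gen_normal p K) (comm_gen_normal K)).

(* Indexed from 1: the term of index 1 is the whole group (and index 0 is a
   dummy value, also the whole group), as in the library's ['L_n(G)]. *)
Definition lower_pseries (p : nat) (G : groupType) (i : nat) : nsubgroup G :=
  iter i.-1 (pseries_step p) (whole G).

Definition lower_plength (p : nat) (G : groupType) (m : nat) : Prop :=
  lower_pseries p G m <> [set 1] :> set G /\
  forall i, (m < i)%N -> lower_pseries p G i = [set 1] :> set G.

Definition lower_plength_le (p : nat) (G : groupType) (n : nat) : Prop :=
  exists2 m, (m <= n)%N & lower_plength p G m.

Definition generated_by (G : groupType) (k : nat) : Prop :=
  exists S : set G, S #= `I_k /\ gen S = [set: G].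

Definition min_generated_by (G : groupType) (d : nat) : Prop :=
  generated_by G d /\ forall k, generated_by G k -> (d <= k)%N.

(** Quotient groups *)

Definition coset_rel (G : groupType) (N : nsubgroup G) : rel G :=
  fun x y => `[< nsub_set N (x^-1 * y) >].

Lemma coset_rel_equiv (G : groupType) (N : nsubgroup G) :
  equiv_class_of (coset_rel N).
Proof.
have [[N1 NM NV] _] := nsubP N.
split=> [x|x y|y x z].
- by apply/asboolP; rewrite mulVg.
- apply/asboolP/asboolP => /NV; by rewrite invgM invgK.
- move=> /asboolP Nxy /asboolP Nyz; apply/asboolP.
  by have := NM _ _ Nxy Nyz; rewrite mulgA mulgK.
Qed.

Definition coset_equiv (G : groupType) (N : nsubgroup G) : equiv_rel G :=
  EquivRelPack (coset_rel_equiv N).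

Definition gquot (G : groupType) (N : nsubgroup G) : Type :=
  {eq_quot (coset_equiv N)}.

HB.instance Definition _ (G : groupType) (N : nsubgroup G) :=
  Choice.on (gquot N).

Definition gcoset (G : groupType) (N : nsubgroup G) (x : G) : gquot N :=
  \pi_({eq_quot (coset_equiv N)})%qT x.

Lemma gcoset_eq (G : groupType) (N : nsubgroup G) (x y : G) :
  gcoset N x = gcoset N y <-> nsub_set N (x^-1 * y).
Proof. by split=> [/eqquotP/asboolP|Nxy]//; apply/eqquotP/asboolP. Qed.

Definition grepr (G : groupType) (N : nsubgroup G) (u : gquot N) : G :=
  generic_quotient.repr u.

Lemma gcoset_repr (G : groupType) (N : nsubgroup G) (u : gquot N) :
  gcoset N (grepr u) = u.
Proof. exact: reprK. Qed.

Definition gquot_mul (G : groupType) (N : nsubgroup G) (u v : gquot N) :=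
  gcoset N (grepr u * grepr v).
Definition gquot_inv (G : groupType) (N : nsubgroup G) (u : gquot N) :=
  gcoset N (grepr u)^-1.
Definition gquot_one (G : groupType) (N : nsubgroup G) := gcoset N 1.

Lemma gcosetM_subproof (G : groupType) (N : nsubgroup G) (x y : G) :
  gquot_mul (gcoset N x) (gcoset N y) = gcoset N (x * y).
Proof.
have [[N1 NM NV] NJ] := nsubP N.
rewrite /gquot_mul; apply/gcoset_eq.
have /gcoset_eq := gcoset_repr (gcoset N x).
have /gcoset_eq := gcoset_repr (gcoset N y).
move: (grepr (gcoset N x)) (grepr (gcoset N y)) => a b Ny Nx.
have -> : (a * b)^-1 * (x * y) = (a^-1 * x) ^ b * (b^-1 * y).
  by rewrite /conjg invgM !mulgA mulgK.
by apply: NM => //; apply: NJ.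
Qed.

Lemma gcosetV_subproof (G : groupType) (N : nsubgroup G) (x : G) :
  gquot_inv (gcoset N x) = gcoset N x^-1.
Proof.
have [[N1 NM NV] NJ] := nsubP N.
rewrite /gquot_inv; apply/gcoset_eq.
have /gcoset_eq := gcoset_repr (gcoset N x).
move: (grepr (gcoset N x)) => a Nx.
have -> : a^-1^-1 * x^-1 = ((a^-1 * x)^-1) ^ a^-1.
  by rewrite /conjg invgM !invgK !mulgA mulgK.
by apply: NJ; apply: NV.
Qed.

Lemma gquot_ind (G : groupType) (N : nsubgroup G) (P : gquot N -> Prop) :
  (forall x, P (gcoset N x)) -> forall u, P u.
Proof. by move=> Px u; rewrite -(gcoset_repr u). Qed.

Lemma gquot_mulA (G : groupType) (N : nsubgroup G) :
  associative (@gquot_mul G N).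
Proof.
elim/gquot_ind => x; elim/gquot_ind => y; elim/gquot_ind => z.
by rewrite !gcosetM_subproof mulgA.
Qed.
Lemma gquot_mul1 (G : groupType) (N : nsubgroup G) :
  left_id (gquot_one N) (@gquot_mul G N).
Proof. by elim/gquot_ind => x; rewrite gcosetM_subproof mul1g. Qed.
Lemma gquot_mulr1 (G : groupType) (N : nsubgroup G) :
  right_id (gquot_one N) (@gquot_mul G N).
Proof. by elim/gquot_ind => x; rewrite gcosetM_subproof mulg1. Qed.
Lemma gquot_mulV (G : groupType) (N : nsubgroup G) :
  left_inverse (gquot_one N) (@gquot_inv G N) (@gquot_mul G N).
Proof.
by elim/gquot_ind => x; rewrite gcosetV_subproof gcosetM_subproof mulVg.
Qed.
Lemma gquot_mulrV (G : groupType) (N : nsubgroup G) :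
  right_inverse (gquot_one N) (@gquot_inv G N) (@gquot_mul G N).
Proof.
by elim/gquot_ind => x; rewrite gcosetV_subproof gcosetM_subproof mulgV.
Qed.

HB.instance Definition _ (G : groupType) (N : nsubgroup G) :=
  isGroup.Build (gquot N) (@gquot_mulA G N) (@gquot_mul1 G N)
    (@gquot_mulr1 G N) (@gquot_mulV G N) (@gquot_mulrV G N).

Lemma gcosetM (G : groupType) (N : nsubgroup G) : hom (gcoset N).
Proof. by move=> x y; rewrite -gcosetM_subproof. Qed.

Lemma hom1 (G H : groupType) (f : G -> H) : hom f -> f 1 = 1.
Proof. by move=> fM; apply: (mulgI (f 1)); rewrite -fM !mulg1. Qed.

Lemma homV (G H : groupType) (f : G -> H) : hom f -> {morph f : x / x^-1}.
Proof.
by move=> fM x; apply: (mulgI (f x)); rewrite -fM !mulgV hom1.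
Qed.

Lemma preim_normal (G : groupType) (N : nsubgroup G) (M : nsubgroup (gquot N)) :
  normal_subgroup (gcoset N @^-1` M).
Proof.
have cM := @gcosetM G N; have [[M1 MM MV] MJ] := nsubP M.
split; first split=> [|x y|x] /=.
- by rewrite (hom1 cM).
- by rewrite cM; apply: MM.
- by rewrite (homV cM); apply: MV.
- by move=> x y /= Mx; rewrite /conjg !cM (homV cM); apply: MJ.
Qed.

(* The subgroup L of G containing N with M = L / N. *)
Definition nsub_preim (G : groupType) (N : nsubgroup G)
    (M : nsubgroup (gquot N)) : nsubgroup G := NSubgroup (preim_normal M).

(* Free groups exist: take words modulo having the same value in every group. *)
Section FreeGroup.
Context (I : choiceType).
Implicit Types (w : seq (I * bool)) (G : groupType).

Definition letter_eval G (y : I -> G) (a : I * bool) : G :=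
  if a.2 then (y a.1)^-1 else y a.1.

Definition word_eval G (y : I -> G) w : G := \prod_(a <- w) letter_eval y a.

Definition word_inv w := rev [seq (a.1, ~~ a.2) | a <- w].

Lemma word_eval_cat G (y : I -> G) w1 w2 :
  word_eval y (w1 ++ w2) = word_eval y w1 * word_eval y w2.
Proof. exact: big_cat. Qed.

Lemma word_eval1 G (y : I -> G) a : word_eval y [:: a] = letter_eval y a.
Proof. exact: big_seq1. Qed.

Lemma word_eval_inv G (y : I -> G) w :
  word_eval y (word_inv w) = (word_eval y w)^-1.
Proof.
elim: w => [|a w IHw]; first by rewrite /word_eval big_nil invg1.
rewrite /word_inv /= rev_cons -cats1 word_eval_cat -/(word_inv w) IHw.
rewrite -(cat1s a w) word_eval_cat !word_eval1 invgM; congr (_ * _).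
by case: a => i [] //=; rewrite /letter_eval /= invgK.
Qed.

Definition word_eqv w1 w2 : bool :=
  `[< forall G (y : I -> G), word_eval y w1 = word_eval y w2 >].

Lemma word_equiv : equiv_class_of word_eqv.
Proof.
split=> [w|w1 w2|w2 w1 w3]; first exact/asboolP.
  by apply/asboolP/asboolP => e G y; rewrite e.
by move=> /asboolP e1 /asboolP e2; apply/asboolP => G y; rewrite e1 e2.
Qed.

Definition word_equiv_rel : equiv_rel (seq (I * bool)) :=
  EquivRelPack word_equiv.

Definition free_group : Type := {eq_quot word_equiv_rel}.
HB.instance Definition _ := Choice.on free_group.

Definition free_cl w : free_group := \pi_({eq_quot word_equiv_rel})%qT w.
Definition free_repr (u : free_group) : seq (I * bool) :=
  generic_quotient.repr u.

Definition free_eval G (y : I -> G) (u : free_group) : G :=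
  word_eval y (free_repr u).

Lemma free_clP w1 w2 : free_cl w1 = free_cl w2 <->
  forall G (y : I -> G), word_eval y w1 = word_eval y w2.
Proof. by split=> [/eqquotP/asboolP|e]//; apply/eqquotP/asboolP. Qed.

Lemma free_evalE G (y : I -> G) w : free_eval y (free_cl w) = word_eval y w.
Proof.
have /free_clP : free_cl (free_repr (free_cl w)) = free_cl w by exact: reprK.
exact.
Qed.

Lemma free_eqP (u v : free_group) :
  (forall G (y : I -> G), free_eval y u = free_eval y v) -> u = v.
Proof.
move=> e; have cl u' : free_cl (free_repr u') = u' by exact: reprK.
by rewrite -(cl u) -(cl v); apply/free_clP.
Qed.

Definition free_mul u v := free_cl (free_repr u ++ free_repr v).
Definition free_inv u := free_cl (word_inv (free_repr u)).
Definition free_one := free_cl [::].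

Lemma free_evalM G (y : I -> G) : {morph free_eval y : u v / free_mul u v >-> u * v}.
Proof. by move=> u v; rewrite free_evalE word_eval_cat. Qed.
Lemma free_evalV G (y : I -> G) : {morph free_eval y : u / free_inv u >-> u^-1}.
Proof. by move=> u; rewrite free_evalE word_eval_inv. Qed.
Lemma free_eval1 G (y : I -> G) : free_eval y free_one = 1.
Proof. by rewrite free_evalE /word_eval big_nil. Qed.

Lemma free_mulA : associative free_mul.
Proof. by move=> u v w; apply: free_eqP => G y; rewrite !free_evalM mulgA. Qed.
Lemma free_mul1 : left_id free_one free_mul.
Proof.
by move=> u; apply: free_eqP => G y; rewrite free_evalM free_eval1 mul1g.
Qed.
Lemma free_mulr1 : right_id free_one free_mul.
Proof.
by move=> u; apply: free_eqP => G y; rewrite free_evalM free_eval1 mulg1.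
Qed.
Lemma free_mulV : left_inverse free_one free_inv free_mul.
Proof.
move=> u; apply: free_eqP => G y.
by rewrite free_evalM free_evalV free_eval1 mulVg.
Qed.
Lemma free_mulrV : right_inverse free_one free_inv free_mul.
Proof.
move=> u; apply: free_eqP => G y.
by rewrite free_evalM free_evalV free_eval1 mulgV.
Qed.

HB.instance Definition _ := isGroup.Build free_group
  free_mulA free_mul1 free_mulr1 free_mulV free_mulrV.

Lemma free_group_free : free_basis (fun i => free_cl [:: (i, false)]).
Proof.
move=> G y; exists (free_eval y); split=> [|f [fM fy]].
  split=> [u v|i]; first exact: free_evalM.
  by rewrite free_evalE word_eval1.
apply/funext => u; have <- : free_cl (free_repr u) = u by exact: reprK.
elim: (free_repr u) => [|[i b] w IHw].
  by rewrite free_evalE /word_eval big_nil (hom1 fM).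
have clM w1 w2 : free_cl (w1 ++ w2) = free_cl w1 * free_cl w2.
  by apply: free_eqP => H z; rewrite free_evalM !free_evalE word_eval_cat.
have clV w1 : free_cl (word_inv w1) = (free_cl w1)^-1.
  by apply: free_eqP => H z; rewrite free_evalV !free_evalE word_eval_inv.
rewrite -cat1s clM fM -IHw free_evalM; congr (_ * _).
case: b; rewrite free_evalE word_eval1 /letter_eval //=.
by rewrite -[[:: _]]/(word_inv [:: (i, false)]) clV (homV fM) fy.
Qed.

End FreeGroup.

(* [set groupType] is universe-inconsistent, so classes of groups are plain
   predicates. *)
Definition group_class : Type := groupType -> Prop.

Definition iso_class (G : groupType) : group_class :=
  fun H => isomorphic G H.

(* The isomorphism classes of finite p-groups satisfying P, where P is invariant
   under isomorphism. *)
Definition pgroup_classes (p : nat) (P : groupType -> Prop) :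
    group_class -> Prop :=
  fun C => exists gT : finGroupType,
    [/\ p.-group [set: gT]%G, P gT & C = iso_class gT].

(* [set_bij] cannot be used at [group_class], again because of universes. *)
Definition bij_between (T U : Type) (A : T -> Prop) (B : U -> Prop)
    (f : T -> U) : Prop :=
  [/\ forall x, A x -> B (f x),
      forall x y, A x -> A y -> f x = f y -> x = y
    & forall z, B z -> exists2 x, A x & f x = z].

Definition image_classes (T : Type) (f : T -> group_class) (A : T -> Prop) :
    group_class -> Prop :=
  fun C => exists2 x, A x & f x = C.

(* The automorphisms of H / Phi(H) induced by those of H, for a finite p-group
   H, whose Frattini subgroup is the second term of its lower p-series. *)
Definition frattini_auts (p : nat) (H : groupType) :
    set (gquot (lower_pseries p H 2) -> gquot (lower_pseries p H 2)) :=
  [set h | aut h /\ exists2 f : H -> H, aut f &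
     forall y, h (gcoset _ y) = gcoset _ (f y)].
Arguments frattini_auts : clear implicits.

Definition trivial_frattini_auts (p : nat) (H : groupType) : Prop :=
  frattini_auts p H = [set idfun].

(* F / F_{n+1} *)
Definition pquot (p n : nat) (F : groupType) : groupType :=
  gquot (lower_pseries p F n.+1).

Definition pcoset (p n : nat) (F : groupType) : F -> pquot p n F :=
  gcoset (lower_pseries p F n.+1).
Arguments pcoset p n {F} _.

(* F_i / F_{n+1}, for i <= n + 1 *)
Definition pterm (p n : nat) (F : groupType) (i : nat) : set (pquot p n F) :=
  pcoset p n @` lower_pseries p F i.
Arguments pterm : clear implicits.

Definition calA (p n : nat) (F : groupType) : set (nsubgroup (pquot p n F)) :=
  [set M | M `<=` pterm p n F 2].
Arguments calA : clear implicits.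

Definition calB (p n : nat) (F : groupType) : set (nsubgroup (pquot p n F)) :=
  [set M | M `<=` pterm p n F 2 /\ ~ (pterm p n F n `<=` M)].
Arguments calB : clear implicits.

Definition calC (p n : nat) (F : groupType) : set (nsubgroup (pquot p n F)) :=
  [set M | M `<=` pterm p n F n].
Arguments calC : clear implicits.

Definition aut_orbit (G : groupType) (M : nsubgroup G) : set (nsubgroup G) :=
  [set M' | exists2 f : G -> G, aut f & M' = f @` M :> set G].

Definition frakA (p n : nat) (F : groupType) :=
  [set aut_orbit M | M in calA p n F].
Arguments frakA : clear implicits.

Definition frakB (p n : nat) (F : groupType) :=
  [set aut_orbit M | M in calB p n F].
Arguments frakB : clear implicits.

Definition frakC (p n : nat) (F : groupType) :=
  [set aut_orbit M | M in calC p n F].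
Arguments frakC : clear implicits.

(* Under the identification of Aut(F / F_2) with GL(d, F_p) given by the basis
   x, the automorphism f of F / F_{n+1} induces the matrix g whose i-th column
   is the vector of coordinates of the image of x_i. *)
Definition gl_induced (p d n : nat) (F : groupType) (x : 'I_d -> F)
    (f : pquot p n F -> pquot p n F) (g : 'M['F_p]_d) : Prop :=
  forall i, pterm p n F 2
    ((\prod_(j < d) pcoset p n (x j) ^+ g j i)^-1 * f (pcoset p n (x i))).

(* For y in F_n / F_{n+1} and g in GL(d, F_p), g.y is the common value at y of
   the automorphisms of F / F_{n+1} inducing g (when x is a basis of F, there
   are such automorphisms, and they all agree on F_n / F_{n+1}). *)
Definition gl_act (p d n : nat) (F : groupType) (x : 'I_d -> F)
    (g : 'M['F_p]_d) (y : pquot p n F) : pquot p n F :=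
  xget y [set z | exists f, [/\ aut f, gl_induced x f g & z = f y]].

Definition gl_orbit (p d n : nat) (F : groupType) (x : 'I_d -> F)
    (M : nsubgroup (pquot p n F)) : set (nsubgroup (pquot p n F)) :=
  [set M' | exists2 g : 'M['F_p]_d, g \in unitmx &
     M' = gl_act x g @` M :> set (pquot p n F)].

Definition gl_orbits (p d n : nat) (F : groupType) (x : 'I_d -> F) :=
  [set gl_orbit x M | M in calC p n F].
Arguments gl_orbits p {d} n {F} x _.

Definition gl_regular (p d n : nat) (F : groupType) (x : 'I_d -> F)
    (O : set (nsubgroup (pquot p n F))) : Prop :=
  forall M : nsubgroup (pquot p n F), O M ->
  forall g : 'M['F_p]_d, g \in unitmx ->
    gl_act x g @` M = M :> set (pquot p n F) -> g = 1%:M%R.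

Definition frakD (p d n : nat) (F : groupType) (x : 'I_d -> F) :=
  [set O | gl_orbits p n x O /\ gl_regular x O].
Arguments frakD p {d} n {F} x _.

(* Main.v *)
From HB Require Import structures.
From mathcomp Require Import all_boot all_order all_algebra.
From mathcomp Require Import all_fingroup all_solvable.
From mathcomp Require Import boolp classical_sets functions cardinality.
Require Import Defs.

Set Implicit Arguments.
Unset Strict Implicit.
Unset Printing Implicit Defensive.

(** The whole proof takes place in the quotient G of the free group F by the
   term of index n+1 of its lower p-series. It is relatively free
   ([rel_free]): it is generated by the images of the basis, and any choice
   of their images in a group whose series is trivial from n+1 on extends to
   a homomorphism. Taking the preimage in F of a normal subgroup M of G does
   not change the quotient, so the theorem is about the groups G/M with M
   contained in the second term.

   Two facts drive everything. First, powers and commutators on the i-th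
   term only depend, modulo the term of index i+2, on classes modulo the
   next term and (for the second entry of a commutator) modulo the second
   term ([lps_congX], [lps_congR]). Consequently homomorphisms that agree
   modulo the second term agree on every section ([hom_lps_cong]), the
   second term consists of non-generators ([lps_nongen]), an endomorphism
   that is invertible modulo the second term is an automorphism
   ([endo2_bij]), and G is finite ([rel_free_finite]). Second, by relative
   freeness the quotient of G by its second term is the space of row vectors
   over F_p with the images of the basis as unit vectors ([rel_free_coord]),
   so that endomorphisms of G induce arbitrary matrices, and those inducing
   invertible ones are the automorphisms ([induces_aut]).

   An isomorphism from G/M to G/M' lifts to an endomorphism of G by
   freeness, and the lift is an automorphism because M and M' lie in the
   second term; hence orbits correspond exactly to isomorphism classes of
   quotients ([aut_orbit_isoP]). If H is minimally generated by d elements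
   and its series is trivial from n+1 on, mapping the basis to generators
   gives H as a quotient G/M; a kernel not inside the second term would make
   one generator of H redundant ([ker_min_generated]). The length of G/M is
   n exactly when M does not contain the n-th term, which gives the
   bijection for the sets B.

   On the n-th term of G an automorphism acts through the matrix that it
   induces, so Aut(G)-orbits and GL(d,p)-orbits of subgroups of that term
   coincide ([gl_orbitE]). The same lifting argument, with M = M', shows
   that the action of Aut(G/M) on the Frattini quotient consists of the
   matrices in the stabilizer of M, which settles the regular orbits
   ([gl_stabilizerP]). *)

Local Open Scope classical_set_scope.
Local Open Scope group_scope.

Local Notation lps := lower_pseries.

(** * Homomorphisms and quotients *)

Section Homs.
Context (G H : groupType) (f : G -> H).
Hypothesis fM : hom f.

Lemma homX k : {morph f : x / x ^+ k}.
Proof.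
by elim: k => [|k IHk] x; rewrite ?expg0 ?(hom1 fM)// !expgS fM IHk.
Qed.

Lemma homJ : {morph f : x y / x ^ y}.
Proof. by move=> x y; rewrite /conjg !fM (homV fM). Qed.

Lemma homR : {morph f : x y / [~ x, y]}.
Proof. by move=> x y; rewrite /commg fM (homV fM) homJ. Qed.

Lemma hom_prod (I : Type) (r : seq I) (E : I -> G) :
  f (\prod_(i <- r) E i) = \prod_(i <- r) f (E i).
Proof.
by elim: r => [|i r IHr]; rewrite ?big_nil ?(hom1 fM)// !big_cons fM IHr.
Qed.

Lemma hom_inj : (forall x, f x = 1 -> x = 1) -> injective f.
Proof.
move=> f1 x y exy; apply: (mulgI x^-1); rewrite mulVg; apply/esym/f1.
by rewrite fM (homV fM) exy mulVg.
Qed.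

End Homs.

Lemma hom_id (G : groupType) : hom (@id G). Proof. by []. Qed.

Lemma hom_comp (G H K : groupType) (g : H -> K) (f : G -> H) :
  hom g -> hom f -> hom (g \o f).
Proof. by move=> gM fM x y /=; rewrite fM gM. Qed.

Lemma iso_comp (G H K : groupType) (g : H -> K) (f : G -> H) :
  iso g -> iso f -> iso (g \o f).
Proof.
by move=> [gM gB] [fM fB]; split; [apply: hom_comp|apply: bij_comp].
Qed.

Lemma iso_inv (G H : groupType) (f : G -> H) : iso f ->
  exists g : H -> G, [/\ iso g, cancel f g & cancel g f].
Proof.
move=> [fM [g fK gK]]; exists g; split=> //; split; last by exists f.
by move=> x y; apply: (can_inj fK); rewrite fM !gK.
Qed.

Lemma isomorphic_sym (G H : groupType) : isomorphic G H -> isomorphic H G.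
Proof. by move=> [f /iso_inv[g [? _ _]]]; exists g. Qed.

Lemma isomorphic_trans (G H K : groupType) :
  isomorphic G H -> isomorphic H K -> isomorphic G K.
Proof. by move=> [f fI] [g gI]; exists (g \o f); apply: iso_comp. Qed.

Lemma iso_classP (G H : groupType) :
  iso_class G = iso_class H <-> isomorphic G H.
Proof.
split=> [e|GH].
  have : iso_class H H by exists id; split=> //; exists id.
  by rewrite -e.
apply/funext => K; apply/propext; split; last exact: isomorphic_trans.
by apply: isomorphic_trans; apply: isomorphic_sym.
Qed.

Lemma equalizer_subgroup (G H : groupType) (f g : G -> H) :
  hom f -> hom g -> subgroup [set x | f x = g x].
Proof.
move=> fM gM; split=> [|x y /= ex ey|x /= ex].
- by rewrite /= (hom1 fM) (hom1 gM).
- by rewrite fM gM ex ey.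
- by rewrite (homV fM) (homV gM) ex.
Qed.

Lemma preimage_subgroup (G H : groupType) (f : G -> H) (K : set H) :
  hom f -> subgroup K -> subgroup (f @^-1` K).
Proof.
move=> fM [K1 KM KV]; split=> [|x y|x]; rewrite /preimage /=.
- by rewrite (hom1 fM).
- by rewrite fM; apply: KM.
- by rewrite (homV fM); apply: KV.
Qed.

Lemma image_subgroup (G H : groupType) (f : G -> H) (K : set G) :
  hom f -> subgroup K -> subgroup (f @` K).
Proof.
move=> fM [K1 KM KV]; split=> [|_ _ [x Kx <-] [y Ky <-]|_ [x Kx <-]].
- by exists 1 => //; rewrite (hom1 fM).
- by exists (x * y); [apply: KM|rewrite fM].
- by exists x^-1; [apply: KV|rewrite (homV fM)].
Qed.

Lemma gen_sub (G : groupType) (S K : set G) :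
  subgroup K -> S `<=` K -> gen S `<=` K.
Proof. by move=> KG SK x; apply. Qed.

Lemma sub_gen (G : groupType) (S : set G) : S `<=` gen S.
Proof. by move=> x Sx K [_ SK]; apply: SK. Qed.

Lemma gen_image (G H : groupType) (f : G -> H) (S : set G) : hom f ->
  (forall z, exists y, f y = z) -> gen S = setT -> gen (f @` S) = setT.
Proof.
move=> fM fS GS; apply/seteqP; split=> // z _; have [y <-] := fS z.
suff: gen S `<=` f @^-1` gen (f @` S) by rewrite GS; apply.
apply: gen_sub => [|{}y Sy]; last by apply: sub_gen; exists y.
by apply: preimage_subgroup fM _; apply: gen_subgroup.
Qed.

Lemma gen1 (G : groupType) (S : set G) : gen S 1.
Proof. by have [] := gen_subgroup S. Qed.

Lemma subgroupX (G : groupType) (K : set G) x k :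
  subgroup K -> K x -> K (x ^+ k).
Proof.
move=> [K1 KM _] Kx; elim: k => [|k IHk]; first by rewrite expg0.
by rewrite expgS; apply: KM.
Qed.

Section Quotients.
Context (G : groupType) (N : nsubgroup G).

Lemma nsub_subgroup : subgroup N. Proof. by have [] := nsubP N. Qed.

Lemma nsub1 : nsub_set N 1. Proof. by have [] := nsub_subgroup. Qed.

Lemma nsubM x y : nsub_set N x -> nsub_set N y -> nsub_set N (x * y).
Proof. by have [_ NM _] := nsub_subgroup; apply: NM. Qed.

Lemma nsubV x : nsub_set N x -> nsub_set N x^-1.
Proof. by have [_ _] := nsub_subgroup; apply. Qed.

Lemma nsubJ x y : nsub_set N x -> nsub_set N (x ^ y).
Proof. by have [_] := nsubP N; apply. Qed.

Lemma nsubX x k : nsub_set N x -> nsub_set N (x ^+ k).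
Proof. exact: subgroupX nsub_subgroup. Qed.

Lemma gcoset1 : gcoset N 1 = 1. Proof. exact: hom1 (@gcosetM G N). Qed.

Lemma gcoset_eq1 x : gcoset N x = 1 <-> nsub_set N x.
Proof.
split=> [|Nx].
  by rewrite -gcoset1 => /esym/gcoset_eq; rewrite invg1 mul1g.
by rewrite -gcoset1; apply/esym/gcoset_eq; rewrite invg1 mul1g.
Qed.

Lemma gcoset_onto u : exists y, gcoset N y = u.
Proof. by exists (grepr u); apply: gcoset_repr. Qed.

Lemma gquot_factor (H : groupType) (f : G -> H) : hom f ->
  (forall x, nsub_set N x -> f x = 1) ->
  exists2 g : gquot N -> H, hom g & forall x, g (gcoset N x) = f x.
Proof.
move=> fM fN; pose g (u : gquot N) := f (grepr u).
have gE x : g (gcoset N x) = f x.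
  have /gcoset_eq/fN := gcoset_repr (gcoset N x).
  by rewrite fM (homV fM) => /mulg1_eq; rewrite invgK.
exists g => //; elim/gquot_ind => x; elim/gquot_ind => y.
by rewrite -gcosetM !gE fM.
Qed.

Lemma gquot_iso (H : groupType) (f : G -> H) : hom f ->
    (forall z, exists x, f x = z) -> (forall x, nsub_set N x <-> f x = 1) ->
  exists2 g : gquot N -> H, iso g & forall x, g (gcoset N x) = f x.
Proof.
move=> fM fS fN; have [|g gM gE] := gquot_factor fM; first by move=> x /fN.
exists g => //; split=> //.
have gI : injective g.
  apply: hom_inj gM _; elim/gquot_ind => x; rewrite gE => /fN Nx.
  exact/gcoset_eq1.
pose h z := gcoset N (projT1 (cid (fS z))).
have hK : cancel h g by move=> z; rewrite /h gE; case: cid.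
by exists h => // u; apply: gI; rewrite hK.
Qed.

End Quotients.

(** * The lower p-series *)

Section LowerSeries.
Context (p : nat).

Section OneGroup.
Context (G : groupType).
Implicit Types N : nsubgroup G.

Lemma pseries_stepX N x : nsub_set N x -> nsub_set (pseries_step p N) (x ^+ p).
Proof.
move=> Nx; exists (x ^+ p); first by apply: sub_gen; exists x.
by exists 1; [apply: gen1|rewrite mulg1].
Qed.

Lemma pseries_stepR N x y :
  nsub_set N x -> nsub_set (pseries_step p N) [~ x, y].
Proof.
move=> Nx; exists 1; first exact: gen1.
by exists [~ x, y]; [apply: sub_gen; exists x => //; exists y|rewrite mul1g].
Qed.

Lemma pseries_step_sub N (K : set G) : subgroup K ->
  (forall x, nsub_set N x -> K (x ^+ p)) ->
  (forall x y, nsub_set N x -> K [~ x, y]) -> pseries_step p N `<=` K.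
Proof.
move=> KG KX KR _ [a aP [b bC ->]]; have [_ KM _] := KG; apply: KM.
  by apply: (gen_sub KG _ aP) => _ [x Nx <-]; apply: KX.
by apply: (gen_sub KG _ bC) => _ [x Nx [y ->]]; apply: KR.
Qed.

Lemma lpsX i x : nsub_set (lps p G i.+1) x -> nsub_set (lps p G i.+2) (x ^+ p).
Proof. exact: pseries_stepX. Qed.

Lemma lpsR i x y :
  nsub_set (lps p G i.+1) x -> nsub_set (lps p G i.+2) [~ x, y].
Proof. exact: pseries_stepR. Qed.

(** The induction principle used for every inclusion out of a term of the
   series: the target only has to be a subgroup, not a normal one. *)
Lemma lpsS_sub i (K : set G) : subgroup K ->
  (forall x, nsub_set (lps p G i.+1) x -> K (x ^+ p)) ->
  (forall x y, nsub_set (lps p G i.+1) x -> K [~ x, y]) ->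
  lps p G i.+2 `<=` K.
Proof. exact: pseries_step_sub. Qed.

Lemma lpsSS i : lps p G i.+1 `<=` lps p G i.
Proof.
case: i => [//|i]; apply: lpsS_sub => [|x Gx|x y Gx].
- exact: nsub_subgroup.
- exact: nsubX.
- by rewrite commgEl; apply: nsubM; [apply: nsubV|apply: nsubJ].
Qed.

Lemma lps_anti i j : (i <= j)%N -> lps p G j `<=` lps p G i.
Proof.
move=> /subnK <-; elim: (j - i)%N => [//|k IHk] x /lpsSS; exact: IHk.
Qed.

Lemma lps_expp_pow y i : nsub_set (lps p G i.+1) (y ^+ (p ^ i)).
Proof. by elim: i => [//|i IHi]; rewrite expnSr expgnA; apply: lpsX. Qed.

Lemma lps_central i x y : nsub_set (lps p G i.+1) x ->
  commute (gcoset (lps p G i.+2) x) (gcoset (lps p G i.+2) y).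
Proof.
move=> /(lpsR y)/gcoset_eq1.
by rewrite (homR (@gcosetM _ _)) => /eqP/commgP.
Qed.

Lemma lps_expp i x : nsub_set (lps p G i.+1) x ->
  gcoset (lps p G i.+2) x ^+ p = 1.
Proof.
by move=> /lpsX/gcoset_eq1; rewrite (homX (@gcosetM _ _)).
Qed.

End OneGroup.
Arguments lps_central {G i x} y _.

Lemma hom_lps (G H : groupType) (f : G -> H) i : hom f ->
  forall x, nsub_set (lps p G i) x -> nsub_set (lps p H i) (f x).
Proof.
move=> fM; case: i => [//|i]; elim: i => [//|i IHi].
apply: (@lpsS_sub _ _ (f @^-1` lps p H i.+2)) => [|x Gx|x y Gx].
- by apply: preimage_subgroup fM _; apply: nsub_subgroup.
- by rewrite /preimage /= (homX fM); apply/lpsX/IHi.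
- by rewrite /preimage /= (homR fM); apply/lpsR/IHi.
Qed.

Lemma lps_surj (G H : groupType) (f : G -> H) i : hom f ->
  (forall z, exists x, f x = z) -> lps p H i = f @` lps p G i :> set H.
Proof.
move=> fM fS; apply/seteqP; split; last first.
  by move=> _ [x Gx <-]; apply: hom_lps.
have base : [set: H] `<=` f @` [set: G].
  by move=> z _; have [x <-] := fS z; exists x.
case: i => [//|i]; elim: i => [//|i IHi].
apply: lpsS_sub => [|_ /IHi[x Gx <-]|_ y /IHi[x Gx <-]].
- by apply: image_subgroup fM _; apply: nsub_subgroup.
- by exists (x ^+ p); [apply: lpsX|rewrite (homX fM)].
- have [y' <-] := fS y.
  by exists [~ x, y']; [apply: lpsR|rewrite (homR fM)].
Qed.

(** Commutation with [x] in the i-th term is, modulo the term of index i+2, a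
   homomorphism into a central subgroup of exponent p; so it kills the second
   term. *)
Lemma commg_lps2 (G : groupType) i (x v : G) : nsub_set (lps p G i.+1) x ->
  nsub_set (lps p G 2) v -> gcoset (lps p G i.+3) [~ x, v] = 1.
Proof.
move=> Gx; set c := gcoset _; have cM : hom c by apply: gcosetM.
pose K := [set v | c [~ x, v] = 1].
have cC w y : commute (c [~ x, w]) y.
  by elim/gquot_ind: y => y; apply: lps_central; apply: lpsR.
have psiM : {morph (fun w => c [~ x, w]) : w y / w * y}.
  move=> w y /=.
  have -> : [~ x, w * y] = [~ x, y] * [~ x, w] ^ y.
    by rewrite /commg /conjg !gnorm.
  by rewrite cM (homJ cM) conjgE (cC w (c y)) mulKg cC.
rewrite -[c _ = 1]/(K v); apply: lpsS_sub v => [|w _|w y _].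
- rewrite -[K]/([set v | (fun w => c [~ x, w]) v = (fun=> 1) v]).
  by apply: equalizer_subgroup => // a b; rewrite mulg1.
- by rewrite /K /= (homX psiM) lps_expp//; apply: lpsR.
- by rewrite /K /= (homR psiM); apply/eqP/commgP/cC.
Qed.

End LowerSeries.

(** * Congruences along the lower p-series *)

Section Congruences.
Context (p : nat).

(** Modulo the term of index i+3, the elements x and x' differ by a central
   factor of exponent p, which disappears from the p-th power. *)
Lemma lps_congX (G : groupType) i (x x' : G) :
  gcoset (lps p G i.+2) x = gcoset (lps p G i.+2) x' ->
  gcoset (lps p G i.+3) (x ^+ p) = gcoset (lps p G i.+3) (x' ^+ p).
Proof.
move=> /gcoset_eq; set u := _ * x' => Gu; rewrite -(mulVKg x x') -/u.
have cM := @gcosetM _ (lps p G i.+3); rewrite !(homX cM) cM expgMn.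
  by rewrite (lps_expp Gu) mulg1.
exact/commute_sym/lps_central.
Qed.

(** A central factor of the first entry disappears from the commutator, and a
   factor in the second term of the second entry does by [commg_lps2]. *)
Lemma lps_congR (G : groupType) i (x x' y y' : G) :
    nsub_set (lps p G i.+1) x' ->
    gcoset (lps p G i.+2) x = gcoset (lps p G i.+2) x' ->
    gcoset (lps p G 2) y = gcoset (lps p G 2) y' ->
  gcoset (lps p G i.+3) [~ x, y] = gcoset (lps p G i.+3) [~ x', y'].
Proof.
move=> Gx' /esym/gcoset_eq; set u := _ * x => Gu /esym/gcoset_eq.
set v := _ * y => Gv; rewrite -(mulVKg x' x) -/u -(mulVKg y' y) -/v.
have cM := @gcosetM _ (lps p G i.+3); set c := gcoset _ in cM *.
have uC w : commute (c u) w by elim/gquot_ind: w => w; apply: lps_central.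
have -> : c [~ x' * u, y' * v] = c [~ x', y' * v].
  rewrite !(homR cM) cM !commgEl invgM conjMg (conjgE (c u)) uC mulKg.
  by rewrite -mulgA (mulgA _ _ (c u)) -uC mulKg.
have -> : [~ x', y' * v] = [~ x', v] * [~ x', y'] ^ v.
  by rewrite /commg /conjg !gnorm.
rewrite cM {1}/c commg_lps2// mul1g (homJ cM) conjgE.
by rewrite [X in _ * X](lps_central v) ?mulKg//; apply: lpsR.
Qed.

(** By induction along the series: on generators of the next term the two
   homomorphisms agree by the two congruences above, and the elements on which
   they agree modulo a given term form a subgroup. *)
Lemma hom_lps_cong (G H : groupType) (f g : G -> H) i y : hom f -> hom g ->
    (forall y, gcoset (lps p H 2) (f y) = gcoset (lps p H 2) (g y)) ->
    nsub_set (lps p G i.+1) y ->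
  gcoset (lps p H i.+2) (f y) = gcoset (lps p H i.+2) (g y).
Proof.
move=> fM gM fg; elim: i y => [y _|i IHi]; first exact: fg.
pose c := gcoset (lps p H i.+3).
suff: lps p G i.+2 `<=` [set y | c (f y) = c (g y)] by apply.
apply: lpsS_sub => [|x Gx|x y Gx] /=.
- by apply: equalizer_subgroup (hom_comp _ fM) (hom_comp _ gM); apply: gcosetM.
- by rewrite (homX fM) (homX gM); apply: lps_congX; apply: IHi.
- rewrite (homR fM) (homR gM); apply: lps_congR; [|exact: IHi|exact: fg].
  exact: hom_lps.
Qed.

(** The terms of the series consist of non-generators: if a subgroup K covers
   the quotient by the second term, then inductively K covers each section. *)
Lemma lps_nongen (G : groupType) (K : set G) n : subgroup K ->
    lps p G n.+1 = [set 1] :> set G ->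
    (forall y, exists2 k, K k & gcoset (lps p G 2) k = gcoset (lps p G 2) y) ->
  forall y, K y.
Proof.
move=> KG Gn KG2; have [K1 KM KV] := KG.
have Ksec i y : nsub_set (lps p G i.+1) y ->
    exists2 k, K k & gcoset (lps p G i.+2) k = gcoset (lps p G i.+2) y.
  elim: i y => [y _|i IHi y]; first exact: KG2.
  pose c := gcoset (lps p G i.+3).
  suff: lps p G i.+2 `<=` c @^-1` (c @` K) by apply.
  apply: lpsS_sub => [|x Gx|x z Gx].
  - apply: preimage_subgroup; first exact: gcosetM.
    by apply: image_subgroup KG; apply: gcosetM.
  - rewrite /preimage /=.
    have [k Kk kx] := IHi x Gx; exists (k ^+ p); last exact: lps_congX.
    exact: subgroupX.
  - rewrite /preimage /=.
    have [k Kk kx] := IHi x Gx; have [l Kl lz] := KG2 z.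
    exists [~ k, l]; last exact: lps_congR.
    rewrite commgEl conjgE; apply: (KM _ _ (KV _ Kk)).
    exact: KM (KV _ Kl) (KM _ _ Kk Kl).
have KGi i y :
    exists2 k, K k & gcoset (lps p G i.+1) k = gcoset (lps p G i.+1) y.
  elim: i => [|i [k Kk /gcoset_eq kG]].
    by exists 1 => //; apply/gcoset_eq.
  have [l Kl /gcoset_eq le] := Ksec i _ kG; exists (k * l); first exact: KM.
  by apply/gcoset_eq; rewrite invgM -mulgA.
move=> y; have [k Kk /gcoset_eq] := KGi n y.
by rewrite Gn => /mulg1_eq; rewrite invgK => <-.
Qed.

(** Such an endomorphism acts trivially on every section, so its kernel sinks
   through the whole series; it is onto since its image covers the quotient by
   the second term. *)
Lemma endo_bij (G : groupType) (f : G -> G) n : hom f ->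
    lps p G n.+1 = [set 1] :> set G ->
    (forall y, gcoset (lps p G 2) (f y) = gcoset (lps p G 2) y) ->
  bijective f.
Proof.
move=> fM Gn f1; rewrite -setTT_bijective; split=> //.
  move=> ? ? _ _; apply: (hom_inj fM) => x fx.
  have: nsub_set (lps p G n.+1) x; last by rewrite Gn.
  elim: n {Gn} => [//|n IHn].
  have := hom_lps_cong fM (@hom_id G) f1 IHn.
  by rewrite fx gcoset1 => /esym/gcoset_eq1.
move=> z _; suff [x _ <-] : (f @` setT) z by exists x.
apply: (lps_nongen _ Gn) z => [|y]; first exact: image_subgroup.
by exists (f y); [exists y|apply: f1].
Qed.

(** Both composites are bijective by [endo_bij], hence so is f; this is what
   turns lifts into automorphisms. *)
Lemma endo2_bij (G : groupType) (f g : G -> G) n : hom f -> hom g ->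
    lps p G n.+1 = [set 1] :> set G ->
    (forall y, gcoset (lps p G 2) (f (g y)) = gcoset (lps p G 2) y) ->
    (forall y, gcoset (lps p G 2) (g (f y)) = gcoset (lps p G 2) y) ->
  bijective f.
Proof.
move=> fM gM Gn fg gf.
have [h hK Kh] := endo_bij (hom_comp fM gM) Gn fg.
have [k kK Kk] := endo_bij (hom_comp gM fM) Gn gf.
have e y : k (g y) = g (h y).
  by rewrite -{1}[y]Kh; apply: kK.
by exists (k \o g) => y /=; [apply: kK|rewrite e; apply: Kh].
Qed.

End Congruences.

(** * Coordinates modulo the second term *)

Section ElementaryAbelian.
Context (p : nat) (p_pr : prime p).

Definition exp_prod (G : groupType) k (z : 'I_k -> G) (v : 'rV['F_p]_k) : G :=
  \prod_(j < k) z j ^+ v ord0 j.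

Section OneGroup.
Context (G : groupType).

Lemma expg_modp (z : G) m : z ^+ p = 1 -> z ^+ (m %% p) = z ^+ m.
Proof.
move=> zp; rewrite [in RHS](divn_eq m p) expgnDr mulnC expgnA zp.
by rewrite expg1n mul1g.
Qed.

(** The exponents add up modulo p, so the exponent hypothesis is what makes the
   formula a homomorphism on vectors over F_p. *)
Lemma exp_prodM k (z : 'I_k -> G) : (forall i j, commute (z i) (z j)) ->
  (forall i, z i ^+ p = 1) -> hom (exp_prod z).
Proof.
move=> zC zp v w; rewrite FinRing.zmodMgE /exp_prod -prodgM_commute; last first.
  by move=> i j _ _; apply: commuteX2.
apply: eq_bigr => j _; rewrite mxE -expgnDr -[RHS](expg_modp _ (zp j)).
by congr (_ ^+ _); rewrite /=; congr (_ %% _); apply: Fp_cast.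
Qed.

Lemma exp_prod_delta k (z : 'I_k -> G) i : exp_prod z ('e_i)%R = z i.
Proof.
rewrite /exp_prod (big_only1 i)// => [|j /negPf ji _]; rewrite mxE !eqxx.
  by rewrite /= expg1.
by rewrite ji.
Qed.

Lemma lps2_trivial : (forall x y : G, commute x y) ->
  (forall x : G, x ^+ p = 1) -> lps p G 2 = [set 1] :> set G.
Proof.
move=> GC Gp; apply/seteqP; split=> [|_ ->]; last exact: nsub1.
apply: lpsS_sub => [|x _|x y _].
- by split=> [//|_ _ -> ->|_ ->] /=; rewrite ?mulg1 ?invg1.
- exact: Gp.
- exact/eqP/commgP/GC.
Qed.

End OneGroup.

Lemma hom_exp_prod (G H : groupType) (f : G -> H) k (z : 'I_k -> G) v :
  hom f -> f (exp_prod z v) = exp_prod (f \o z) v.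
Proof.
by move=> fM; rewrite hom_prod//; apply: eq_bigr => j _; rewrite homX.
Qed.

(** Makes the additive group of row vectors an admissible target for the
   extension property of relatively free groups. *)
Lemma rV_lps k n : (1 <= n)%N ->
  lps p 'rV['F_p]_k n.+1 = [set 1] :> set 'rV['F_p]_k.
Proof.
move=> n1; apply/seteqP; split=> [v|_ ->]; last exact: nsub1.
move=> /(@lps_anti _ _ 2 n.+1 n1); rewrite lps2_trivial// => {}v.
  by move=> w; rewrite /commute !FinRing.zmodMgE GRing.addrC.
rewrite FinRing.zmodXgE FinRing.zmod1gE; apply/rowP => j.
by rewrite mulmxnE mxE -GRing.mulr_natr pchar_Fp_0// GRing.mulr0.
Qed.

End ElementaryAbelian.

(** What is used of the quotient of a free group by the term of index n+1 of its
   lower p-series. *)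
Definition rel_free p n d (G : groupType) (x : 'I_d -> G) : Prop :=
  [/\ lps p G n.+1 = [set 1] :> set G, gen (range x) = setT &
     forall (H : groupType) (y : 'I_d -> H), lps p H n.+1 = [set 1] :> set H ->
       exists2 f : G -> H, hom f & forall i, f (x i) = y i].

Lemma gen_hom_eq (G H : groupType) (S : set G) (f g : G -> H) :
    gen S = setT -> hom f -> hom g -> (forall x, S x -> f x = g x) ->
  forall y, f y = g y.
Proof.
move=> GS fM gM fg y; have: [set: G] y by []; rewrite -GS.
by apply: (gen_sub (equalizer_subgroup fM gM)).
Qed.

(** The columns of g are the coordinates of the images of the generators, so
   that composition of endomorphisms becomes the product of matrices. *)
Definition induces p d (G : groupType) (x : 'I_d -> G) (f : G -> G)
    (g : 'M['F_p]_d) : Prop :=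
  forall i, nsub_set (lps p G 2) ((\prod_(j < d) x j ^+ g j i)^-1 * f (x i)).

Section RelFree.
Context (p n d : nat) (p_pr : prime p) (n_gt0 : (1 <= n)%N).
Context (G : groupType) (x : 'I_d -> G) (xG : rel_free p n x).
Implicit Types (f h : G -> G) (g : 'M['F_p]_d).

Lemma rel_free_eq (H : groupType) (f g : G -> H) : hom f -> hom g ->
  (forall i, f (x i) = g (x i)) -> forall y, f y = g y.
Proof.
have [_ Gx _] := xG; move=> fM gM fg; apply: (gen_hom_eq Gx) => // _ [i _ <-].
exact: fg.
Qed.

Lemma lps2_expp (y : gquot (lps p G 2)) : y ^+ p = 1.
Proof. by elim/gquot_ind: y => y; apply: lps_expp. Qed.

Lemma lps2_commute (y z : gquot (lps p G 2)) : commute y z.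
Proof.
by elim/gquot_ind: y => y; elim/gquot_ind: z => z; apply: lps_central.
Qed.

(** The map lam sends the generators to the unit vectors; it exists by relative
   freeness. The map in the other direction, given by [exp_prod], shows that lam
   is injective modulo the second term, since the two composites agree on
   generators. *)
Lemma rel_free_coord : exists lam : G -> 'rV['F_p]_d,
  [/\ hom lam, forall i, lam (x i) = ('e_i)%R,
      forall y, gcoset (lps p G 2) y = gcoset (lps p G 2) (exp_prod x (lam y))
    & forall y z,
        lam y = lam z <-> gcoset (lps p G 2) y = gcoset (lps p G 2) z].
Proof.
have [_ _ xP] := xG.
have [lam lamM lamx] :=
  xP _ (fun i => ('e_i)%R : 'rV['F_p]_d) (rV_lps p_pr d n_gt0).
have cM := @gcosetM _ (lps p G 2); set c := gcoset _ in cM *.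
have yE y : c y = c (exp_prod x (lam y)).
  rewrite hom_exp_prod//.
  apply: (@rel_free_eq _ c (exp_prod (c \o x) \o lam)) => //= [|i].
    apply: hom_comp lamM; apply: exp_prodM => // [i j|i].
      exact: lps2_commute.
    exact: lps2_expp.
  by rewrite lamx exp_prod_delta.
exists lam; split=> // y z; split=> [e|/gcoset_eq/(hom_lps lamM)].
  by rewrite yE e -yE.
rewrite (@rV_lps _ p_pr d 1)// lamM (homV lamM) => /mulg1_eq.
by rewrite invgK.
Qed.

(** In coordinates, the matrix acts on row vectors through its transpose. *)
Lemma inducesP (lam : G -> 'rV['F_p]_d) f g :
    hom lam -> (forall i, lam (x i) = ('e_i)%R) ->
    (forall y z,
       lam y = lam z <-> gcoset (lps p G 2) y = gcoset (lps p G 2) z) ->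
  induces x f g <-> forall i, lam (f (x i)) = row i g^T.
Proof.
move=> lamM lamx lamE.
suff e i : nsub_set (lps p G 2) ((\prod_(j < d) x j ^+ g j i)^-1 * f (x i)) <->
    lam (f (x i)) = row i g^T.
  by split=> h i; apply/e/h.
rewrite -gcoset_eq -lamE.
have -> : \prod_(j < d) x j ^+ g j i = exp_prod x (row i g^T).
  by apply: eq_bigr => j _; rewrite !mxE.
rewrite hom_exp_prod//.
have -> : exp_prod (lam \o x) (row i g^T) = row i g^T; last by split.
rewrite [LHS](_ : _ = (\sum_j g j i *: 'e_j)%R); last first.
  rewrite /exp_prod; elim/big_rec2: _ => [//|j v w _ ->].
  rewrite FinRing.zmodMgE FinRing.zmodXgE !mxE /= lamx.
  by rewrite -GRing.scaler_nat natr_Zp.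
by rewrite [RHS]row_sum_delta; apply: eq_bigr => j _; rewrite !mxE.
Qed.

Lemma induces_endo g : exists2 f : G -> G, hom f & induces x f g.
Proof.
have [Gn _ xP] := xG.
have [f fM fx] := xP _ (fun i => \prod_(j < d) x j ^+ g j i) Gn.
by exists f => // i; rewrite fx mulVg; apply: nsub1.
Qed.

Lemma induces_ex f : exists g, induces x f g.
Proof.
have [lam [lamM lamx lamP lamE]] := rel_free_coord.
exists (\matrix_(j, i) lam (f (x i)) ord0 j)%R.
apply/(inducesP _ _ lamM lamx lamE).
by move=> i; apply/rowP => j; rewrite !mxE.
Qed.

Lemma induces_inj f g g' : induces x f g -> induces x f g' -> g = g'.
Proof.
have [lam [lamM lamx _ lamE]] := rel_free_coord.
move=> /(inducesP _ _ lamM lamx lamE) fg /(inducesP _ _ lamM lamx lamE) fg'.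
by apply: (can_inj (@trmxK _ _ _)); apply/row_matrixP => i; rewrite -fg fg'.
Qed.

Lemma induces_cong f f' g : hom f -> hom f' ->
    induces x f g -> induces x f' g ->
  forall y, gcoset (lps p G 2) (f y) = gcoset (lps p G 2) (f' y).
Proof.
move=> fM f'M; have [lam [lamM lamx _ lamE]] := rel_free_coord.
move=> /(inducesP _ _ lamM lamx lamE) fg /(inducesP _ _ lamM lamx lamE) fg' y.
apply/lamE; apply: (@rel_free_eq _ (lam \o f) (lam \o f')) => [||i /=].
- exact: hom_comp.
- exact: hom_comp.
- by rewrite fg fg'.
Qed.

Lemma cong_induces f f' g : 
  (forall y, gcoset (lps p G 2) (f y) = gcoset (lps p G 2) (f' y)) ->
  induces x f g -> induces x f' g.
Proof.
move=> ff' fg i; apply/gcoset_eq; rewrite -ff'; exact/gcoset_eq.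
Qed.

Lemma induces_id : induces x id (1%:M : 'M['F_p]_d)%R.
Proof.
have [lam [lamM lamx _ lamE]] := rel_free_coord.
by apply/(inducesP _ _ lamM lamx lamE) => i; rewrite lamx trmx1 row1.
Qed.

Lemma induces_comp f f' g g' : hom f -> hom f' ->
  induces x f g -> induces x f' g' -> induces x (f \o f') (g *m g')%R.
Proof.
move=> fM f'M; have [lam [lamM lamx _ lamE]] := rel_free_coord.
move=> /(inducesP _ _ lamM lamx lamE) fg /(inducesP _ _ lamM lamx lamE) fg'.
apply/(inducesP _ _ lamM lamx lamE) => i /=.
have lamf y : lam (f y) = (lam y *m g^T)%R.
  apply: (@rel_free_eq _ (lam \o f) (fun y => lam y *m g^T)%R)
    => {y} [|y z|j] /=.
  - exact: hom_comp.
  - by rewrite lamM !FinRing.zmodMgE mulmxDl.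
  - by rewrite fg lamx rowE.
by rewrite lamf fg' trmx_mul row_mul.
Qed.

(** An endomorphism inducing the inverse matrix is an inverse modulo the second
   term, so [endo2_bij] applies. *)
Lemma induces_aut f g : hom f -> induces x f g -> (g \in unitmx <-> aut f).
Proof.
have [Gn _ _] := xG; move=> fM fg; split=> [gU|fI].
  have [h hM hg] := induces_endo (invmx g); split=> //.
  have id_cong k : hom k -> induces x k (1%:M : 'M['F_p]_d)%R ->
      forall y, gcoset (lps p G 2) (k y) = gcoset (lps p G 2) y.
    by move=> kM k1; apply: induces_cong kM (@hom_id G) k1 induces_id.
  apply: (endo2_bij fM hM Gn); apply: (id_cong (_ \o _)); try exact: hom_comp.
    by rewrite -(mulmxV gU); apply: induces_comp.
  by rewrite -(mulVmx gU); apply: induces_comp.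
have [h [[hM _] fK hK]] := iso_inv fI.
have [g' hg'] := induces_ex h.
suff /mulmx1_unit[] : (g *m g')%R = 1%:M%R by [].
apply: (@induces_inj id); last exact: induces_id.
by apply: cong_induces (induces_comp fM hM fg hg') => y /=; rewrite hK.
Qed.

End RelFree.

(** * The quotients of a free group by its lower p-series *)

Lemma word_eval_sub (I : choiceType) (G : groupType) (y : I -> G)
    (K : set G) w :
  subgroup K -> range y `<=` K -> K (word_eval y w).
Proof.
move=> [K1 KM KV] yK; rewrite /word_eval; elim/big_rec: _ => [//|[i b] z _ Kz].
apply: KM => //; have Ki : K (y i) by apply: yK; exists i.
by rewrite /letter_eval; case: b => //=; apply: KV.
Qed.

(** Composing the map to the group of words given by freeness with evaluation
   yields the identity, so every element is the value of a word. *)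
Lemma free_basis_gen (I : choiceType) (F : groupType) (x : I -> F) :
  free_basis x -> gen (range x) = setT.
Proof.
move=> xF; apply/seteqP; split=> // y _.
have [g [[gM gx] _]] := xF (free_group I) (fun i => free_cl [:: (i, false)]).
have [h [_ hU]] := xF F x.
have e1 : h = id by apply: hU.
have e2 : h = free_eval x \o g.
  apply: hU; split=> [|i /=]; last by rewrite gx free_evalE word_eval1.
  by apply: hom_comp gM => u v; apply: free_evalM.
have -> : y = free_eval x (g y) by rewrite -[LHS]/(id y) -e1 e2.
exact: word_eval_sub (gen_subgroup _) (@sub_gen _ _).
Qed.

Lemma pterm_lps p n (F : groupType) i : pterm p n F i = lps p (pquot p n F) i.
Proof.
by rewrite (lps_surj _ _ (@gcosetM _ _))//; apply: gcoset_onto.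
Qed.

Lemma pquot_lps p n (F : groupType) :
  lps p (pquot p n F) n.+1 = [set 1] :> set (pquot p n F).
Proof.
rewrite -pterm_lps; apply/seteqP; split=> [_ [y Fy <-]|_ ->].
  exact/gcoset_eq1.
by exists 1; [apply: nsub1|apply: gcoset1].
Qed.

Lemma pquot_rel_free p n d (F : groupType) (x : 'I_d -> F) :
  free_basis x -> rel_free p n (pcoset p n \o x).
Proof.
move=> xF; split=> [||H y Hn]; first exact: pquot_lps.
  rewrite -(image_comp x (pcoset p n)).
  exact: gen_image (@gcosetM _ _) (@gcoset_onto _ _) (free_basis_gen xF).
have [f [[fM fx] _]] := xF H y.
have [z /(hom_lps fM)|g gM gE] := gquot_factor (N := lps p F n.+1) fM.
  by rewrite Hn.
by exists g => // i; rewrite /= gE.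
Qed.

(** * Finiteness *)

Section Finiteness.
Context (p : nat) (p_pr : prime p).

(** The subgroup is covered by the products of powers of the elements of S with
   exponents in F_p. *)
Lemma gen_finite (G : groupType) (S : set G) : finite_set S ->
  (forall y z, S y -> S z -> commute y z) -> (forall y, S y -> y ^+ p = 1) ->
  finite_set (gen S).
Proof.
move=> /finite_seqP[s ->] sC sp; pose z := tnth (in_tuple s).
have zs i : z i \in s by apply: mem_tnth.
apply: (@sub_finite_set _ _ (range (exp_prod (p := p) z))); last first.
  by apply: finite_image; apply: finite_finset.
apply: gen_sub => [|y /= /(@tnthP _ _ (in_tuple s))[i ->]]; last first.
  by exists ('e_i)%R => //; apply: exp_prod_delta.
apply: image_subgroup => //.
by apply: exp_prodM => // [i j|i]; [apply: sC; apply: zs|apply: sp; apply: zs].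
Qed.

(** The section of index i+2 is generated by p-th powers and commutators, and by
   [lps_congX] and [lps_congR] these only depend on classes in the quotients by
   the terms of index i+2 and 2; so finitely many of them suffice. *)
Lemma lps_finite (G : groupType) i : finite_set [set: gquot (lps p G 2)] ->
  finite_set [set: gquot (lps p G i.+2)].
Proof.
move=> G2; elim: i => [//|i IHi].
pose c := gcoset (lps p G i.+3); have cM : hom c by apply: gcosetM.
pose S : set (gquot (lps p G i.+3)) :=
  [set c (x ^+ p) | x in lps p G i.+1] `|`
  [set c [~ x, y] | x in lps p G i.+1 & y in setT].
have SG q : S q -> exists2 z, nsub_set (lps p G i.+2) z & q = c z.
  case=> [[x Gx <-]|[x Gx [y _ <-]]].
    by exists (x ^+ p) => //; apply: lpsX.
  by exists [~ x, y] => //; apply: lpsR.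
have Sfin : finite_set S.
  have A := finite_image (fun u : gquot (lps p G i.+2) => c (grepr u ^+ p)) IHi.
  have B := finite_image2
    (fun (u : gquot (lps p G i.+2)) (v : gquot (lps p G 2)) =>
       c [~ grepr u, grepr v]) IHi G2.
  apply: sub_finite_set (_ : finite_set (_ `|` _)); last first.
    by rewrite finite_setU; split; [exact: A|exact: B].
  apply: setUSS => [_ [x Gx <-]|_ [x Gx [y _ <-]]].
    exists (gcoset _ x) => //; apply: lps_congX; exact: gcoset_repr.
  exists (gcoset _ x) => //; exists (gcoset _ y) => //.
  by apply: lps_congR => //; apply: gcoset_repr.
have Gfin : finite_set (gen S).
  apply: gen_finite Sfin _ _ => [y z /SG[u Gu ->] /SG[v Gv ->]|y /SG[u Gu ->]].
    exact: lps_central.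
  exact: lps_expp.
apply: sub_finite_set (finite_image2
  (fun u k => c (@grepr _ (lps p G i.+2) u) * k) IHi Gfin).
move=> q _; have [y <-] := gcoset_onto q.
have /gcoset_eq := gcoset_repr (gcoset (lps p G i.+2) y).
set r := grepr _; set z := _ * y => Gz.
exists (gcoset _ y) => //; exists (c z); last by rewrite -cM mulVKg.
suff: lps p G i.+2 `<=` c @^-1` gen S by apply.
apply: lpsS_sub => [|x Gx|x w Gx].
- by apply: preimage_subgroup cM _; apply: gen_subgroup.
- by apply: sub_gen; left; exists x.
- by apply: sub_gen; right; exists x => //; exists w.
Qed.

Lemma rel_free_finite n d (G : groupType) (x : 'I_d -> G) : (1 <= n)%N ->
  rel_free p n x -> finite_set [set: G].
Proof.
move=> n_gt0 xG; have [lam [_ _ lamP _]] := rel_free_coord p_pr n_gt0 xG.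
have [Gn _ _] := xG.
have G2 : finite_set [set: gquot (lps p G 2)].
  apply: (@sub_finite_set _ _
    (range (gcoset (lps p G 2) \o exp_prod (p := p) x))).
    by move=> u _; have [y <-] := gcoset_onto u; exists (lam y).
  by apply: finite_image; apply: finite_finset.
rewrite -(prednK n_gt0) in Gn.
rewrite -(preimage_setT (gcoset (lps p G n.-1.+2))).
apply: finite_preimage (lps_finite _ G2) => y z _ _ /gcoset_eq.
by rewrite Gn => /mulg1_eq; rewrite invgK.
Qed.

Lemma card_eq_ordinal (T : Type) (S : set T) k : (S #= `I_k)%card ->
  exists2 z : 'I_k -> T, injective z & range z = S.
Proof.
move=> /card_set_bijP[f [fIk fI fS]].
have zP (i : 'I_k) : exists y, S y /\ f y = i.
  by have [y Sy fy] := fS i (ltn_ord i); exists y.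
pose z i := projT1 (cid (zP i)).
have zS i : S (z i) by rewrite /z; case: cid => y [].
have fz i : f (z i) = i by rewrite /z; case: cid => y [].
exists z => [i j e|]; first by apply: val_inj; rewrite /= -!fz e.
apply/seteqP; split=> [_ [i _ <-]//|y Sy].
exists (Ordinal (fIk y Sy : (f y < k)%N)) => //.
by apply: fI; rewrite ?inE// fz.
Qed.

(** Transporting the structure to an ordinal avoids any constraint between the
   universe of G and that of finite groups. *)
Lemma finite_group_iso (G : groupType) : finite_set [set: G] ->
  exists gT : finGroupType, isomorphic G gT.
Proof.
move=> /finite_setP[k /card_eq_ordinal[f fI fT]].
have fS y : exists i, f i = y.
  by have: [set: G] y by []; rewrite -fT => -[i _ <-]; exists i.
pose g y : 'I_k := projT1 (cid (fS y)).
have gK : cancel g f by move=> y; rewrite /g; case: cid.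
have fK : cancel f g by move=> i; apply: fI; rewrite gK.
pose mul (a b : 'I_k) := g (f a * f b).
have mulA : associative mul by move=> a b c; rewrite /mul !gK mulgA.
have mul1 : left_id (g 1) mul by move=> a; rewrite /mul gK mul1g fK.
have mulV : left_inverse (g 1) (fun a : 'I_k => g (f a)^-1) mul.
  by move=> a; rewrite /mul gK mulVg.
pose gT : finGroupType :=
  HB.pack 'I_k (Finite_isGroup.Build 'I_k mulA mul1 mulV).
exists gT, (g : G -> gT); split; last by exists f.
by move=> y z; rewrite -{1}(gK y) -{1}(gK z).
Qed.

End Finiteness.

(** * Invariance under isomorphism *)

Section Invariance.
Context (p : nat).

Lemma lps_trivialP (G : groupType) i :
  lps p G i = [set 1] :> set G <-> forall y, nsub_set (lps p G i) y -> y = 1.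
Proof.
split=> [-> //|G1]; apply/seteqP; split=> [y /G1->//|_ ->]; exact: nsub1.
Qed.

Lemma lps_trivial_iso (G H : groupType) i : isomorphic G H ->
  lps p G i = [set 1] :> set G -> lps p H i = [set 1] :> set H.
Proof.
move=> /isomorphic_sym[f [fM /bij_inj fI]] /lps_trivialP G1.
apply/lps_trivialP => y /(hom_lps fM)/G1 fy.
by apply: fI; rewrite fy (hom1 fM).
Qed.

Lemma lower_plengthP (G : groupType) n : lower_plength p G n <->
  lps p G n <> [set 1] :> set G /\ lps p G n.+1 = [set 1] :> set G.
Proof.
split=> -[Gn GS]; split=> //; first exact: GS.
move=> i ni; apply/lps_trivialP => y /(lps_anti ni); move: y.
exact/lps_trivialP.
Qed.

(** For a nontrivial group a last nontrivial term exists as soon as some term is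
   trivial. *)
Lemma lower_plength_leP (G : groupType) n : (exists y : G, y <> 1) ->
  lower_plength_le p G n <-> lps p G n.+1 = [set 1] :> set G.
Proof.
move=> [y y1]; split=> [[m mn [_ Gm]]|Gn]; first exact: Gm.
pose P m := ~~ `[< lps p G m = [set 1] :> set G >].
have P0 : exists m, P m.
  by exists 0; apply/asboolPn => /lps_trivialP/(_ y I).
have Pn m : P m -> (m <= n)%N.
  rewrite leqNgt; apply: contraNN => nm; apply/asboolP/lps_trivialP => z.
  by move/(lps_anti nm); move: z; apply/lps_trivialP.
case: (ex_maxnP P0 Pn) => m Pm mmax; exists m; first exact: Pn.
split; first exact/asboolPn.
move=> i mi; apply: contrapT => Gi.
have /mmax : P i by apply/asboolPn.
by rewrite leqNgt mi.
Qed.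

Lemma generated_byP (G : groupType) k : generated_by G k <->
  exists2 z : 'I_k -> G, injective z & gen (range z) = setT.
Proof.
split=> [[S [/card_eq_ordinal[z zI <-] GS]]|[z zI GS]]; first by exists z.
exists (range z); split=> //.
apply: card_eq_trans (inj_card_eq _) (card_esym card_II).
by move=> i j _ _; apply: zI.
Qed.

Lemma min_generated_by_iso (G H : groupType) k : isomorphic G H ->
  min_generated_by G k -> min_generated_by H k.
Proof.
have tr G' H' m : isomorphic G' H' -> generated_by G' m -> generated_by H' m.
  move=> [f [fM fB]] /generated_byP[z zI GS]; apply/generated_byP.
  exists (f \o z); first exact: inj_comp (bij_inj fB) zI.
  rewrite -(image_comp z f); apply: gen_image fM _ GS => y.
  by case: fB => g _ gK; exists (g y).
move=> GH [Gk Gmin]; split; first exact: tr GH Gk.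
by move=> m /(tr _ _ _ (isomorphic_sym GH)); apply: Gmin.
Qed.

(** Every automorphism descends to the quotient by the second term, because the
   second term is preserved by homomorphisms. *)
Lemma trivial_frattini_autsP (H : groupType) : trivial_frattini_auts p H <->
  forall f : H -> H, aut f ->
    forall y, gcoset (lps p H 2) (f y) = gcoset (lps p H 2) y.
Proof.
split=> [tH f fA y|fH].
  pose c := gcoset (lps p H 2); have cM : hom c by apply: gcosetM.
  have [h hM hE] : exists2 h, hom h & forall y, h (c y) = c (f y).
    have [fM _] := fA; apply: (gquot_factor (hom_comp cM fM)) => z Hz.
    exact/gcoset_eq1/hom_lps.
  suff : [set idfun] h by move=> /= h1; rewrite -/c -hE h1.
  rewrite -tH; split; last by exists f.
  have [g [[gM gB] fK gK]] := iso_inv fA.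
  have [k kM kE] : exists2 k, hom k & forall y, k (c y) = c (g y).
    apply: (gquot_factor (hom_comp cM gM)) => z Hz.
    exact/gcoset_eq1/hom_lps.
  split=> //; exists k; elim/gquot_ind => z.
    by rewrite hE kE fK.
  by rewrite kE hE gK.
apply/seteqP; split=> [h [_ [f fA hE]]|_ ->].
  by apply/funext; elim/gquot_ind => y; rewrite hE fH.
by split; [split=> //; exists idfun|exists id => //; split=> //; exists id].
Qed.

Lemma trivial_frattini_auts_iso (G H : groupType) : isomorphic G H ->
  trivial_frattini_auts p G -> trivial_frattini_auts p H.
Proof.
move=> [e eI] /trivial_frattini_autsP tG.
apply/trivial_frattini_autsP => f fA y.
have [e' [e'I eK e'K]] := iso_inv eI.
have : gcoset (lps p G 2) (e' (f (e (e' y)))) = gcoset (lps p G 2) (e' y).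
  exact: tG (iso_comp (iso_comp e'I fA) eI) (e' y).
move=> /gcoset_eq; case: eI => eM _ /(hom_lps eM).
by rewrite eM (homV eM) !e'K => /gcoset_eq.
Qed.

End Invariance.

(** * Orbits of normal subgroups and isomorphism classes of quotients *)

Lemma aut_orbit_refl (G : groupType) (M : nsubgroup G) : aut_orbit M M.
Proof. by exists id; [split=> //; exists id|rewrite image_id]. Qed.

Lemma aut_orbit_eq (G : groupType) (M M' : nsubgroup G) :
  aut_orbit M = aut_orbit M' <-> aut_orbit M M'.
Proof.
split=> [->|]; first exact: aut_orbit_refl.
have sub (N N' : nsubgroup G) : aut_orbit N N' -> aut_orbit N' `<=` aut_orbit N.
  move=> [f fA NE] P [g gA PE]; exists (g \o f); first exact: iso_comp.
  by rewrite PE NE image_comp.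
move=> MM'; apply/seteqP; split; apply: sub => //.
have [f fA ME] := MM'; have [g [gA fK gK]] := iso_inv fA.
exists g => //; rewrite ME image_comp (_ : g \o f = id) ?image_id//.
exact/funext.
Qed.

Section RelFreeQuotients.
Context (p n d : nat) (p_pr : prime p) (n_gt0 : (1 <= n)%N).
Context (G : groupType) (x : 'I_d -> G) (xG : rel_free p n x).
Implicit Types M : nsubgroup G.

Lemma aut_quotient M M' (f : G -> G) : aut f -> M' = f @` M :> set G ->
  exists2 h : gquot M -> gquot M', iso h &
    forall y, h (gcoset M y) = gcoset M' (f y).
Proof.
move=> fA ME; have [fM fB] := fA; have [g [_ fK gK]] := iso_inv fA.
apply: (gquot_iso (f := gcoset M' \o f)) => [|u|y] /=.
- by apply: hom_comp fM; apply: gcosetM.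
- by have [z <-] := gcoset_onto u; exists (g z); rewrite /= gK.
rewrite gcoset_eq1 ME; split=> [My|[z Mz /(can_inj fK)<-//]].
by exists y.
Qed.

Lemma lift_hom M M' (h : gquot M -> gquot M') : hom h ->
  exists2 f : G -> G, hom f & forall y, gcoset M' (f y) = h (gcoset M y).
Proof.
have [Gn _ xP] := xG => hM.
have [f fM fx] := xP _ (fun i => grepr (h (gcoset M (x i)))) Gn.
exists f => //.
apply: (rel_free_eq xG (f := gcoset M' \o f) (g := h \o gcoset M)).
- by apply: hom_comp fM; apply: gcosetM.
- by apply: hom_comp hM _; apply: gcosetM.
- by move=> i /=; rewrite fx gcoset_repr.
Qed.

Lemma gcoset_sub (N M : nsubgroup G) y z : M `<=` N ->
  gcoset M y = gcoset M z -> gcoset N y = gcoset N z.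
Proof. by move=> MN /gcoset_eq/MN/gcoset_eq. Qed.

(** Lifts of h and of its inverse are inverse to each other modulo the second
   term, so [endo2_bij] applies. *)
Lemma lift_aut M M' (h : gquot M -> gquot M') : iso h ->
    M `<=` lps p G 2 -> M' `<=` lps p G 2 ->
  exists f : G -> G, [/\ aut f, M' = f @` M :> set G &
    forall y, gcoset M' (f y) = h (gcoset M y)].
Proof.
move=> hI M2 M'2; have [Gn _ _] := xG.
have [h' [h'I hK h'K]] := iso_inv hI.
have [[hM hB] [h'M h'B]] := (hI, h'I).
have [f fM fE] := lift_hom hM; have [g gM gE] := lift_hom h'M.
have fB : bijective f.
  apply: (endo2_bij fM gM Gn) => y.
    by apply: (gcoset_sub M'2); rewrite fE gE h'K.
  by apply: (gcoset_sub M2); rewrite gE fE hK.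
exists f; split=> //.
have fP y : nsub_set M y <-> nsub_set M' (f y).
  rewrite -!gcoset_eq1 fE; split=> [->|]; first exact: hom1.
  by rewrite -(hom1 hM) => /(bij_inj hB).
apply/seteqP; split=> [z|_ [y My <-]]; last exact/fP.
by case: fB => k fK kK; rewrite -(kK z) => /fP; exists (k z).
Qed.

Lemma aut_orbit_isoP M M' : M `<=` lps p G 2 -> M' `<=` lps p G 2 ->
  aut_orbit M = aut_orbit M' <-> isomorphic (gquot M) (gquot M').
Proof.
move=> M2 M'2; rewrite aut_orbit_eq; split=> [[f fA ME]|[h hI]].
  by have [h hI _] := aut_quotient fA ME; exists h.
by have [f [fA ME _]] := lift_aut hI M2 M'2; exists f.
Qed.

(** The quotients of G and of G/M by their second terms are the same. *)
Lemma lps2_gcoset M y : M `<=` lps p G 2 ->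
  nsub_set (lps p (gquot M) 2) (gcoset M y) <-> nsub_set (lps p G 2) y.
Proof.
move=> M2; split; last exact/hom_lps/gcosetM.
rewrite (lps_surj _ _ (@gcosetM _ M) (@gcoset_onto _ M)).
move=> -[z Gz /gcoset_eq/M2 zy].
by rewrite -(mulVKg z y); apply: nsubM.
Qed.

(** Automorphisms of the quotient lift, so they all act trivially modulo the
   second term exactly when those of the free object that preserve M do. *)
Lemma trivial_frattini_quotient M : M `<=` lps p G 2 ->
  trivial_frattini_auts p (gquot M) <->
  forall f : G -> G, aut f -> M = f @` M :> set G ->
    forall y, gcoset (lps p G 2) (f y) = gcoset (lps p G 2) y.
Proof.
move=> M2; rewrite trivial_frattini_autsP; split=> [tM f fA ME y|tM h hI].
  have [h hI hE] := aut_quotient fA ME.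
  have /gcoset_eq := tM h hI (gcoset M y).
  rewrite hE -(homV (@gcosetM _ M)) -gcosetM => /(lps2_gcoset _ M2).
  by move/gcoset_eq.
have [f [fA ME fE]] := lift_aut hI M2 M2.
elim/gquot_ind => y; have /gcoset_eq := tM f fA ME y.
move=> /(hom_lps (@gcosetM _ M)); rewrite gcosetM (homV (@gcosetM _ M)) fE.
by move/gcoset_eq.
Qed.

Lemma quotient_lps M : lps p (gquot M) n.+1 = [set 1] :> set (gquot M).
Proof.
have [Gn _ _] := xG; apply/lps_trivialP => u.
rewrite (lps_surj _ _ (@gcosetM _ M) (@gcoset_onto _ M)) Gn => -[_ -> <-].
exact: gcoset1.
Qed.

Lemma quotient_lps_n M :
  lps p (gquot M) n = [set 1] :> set (gquot M) <-> lps p G n `<=` M.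
Proof.
split=> [Mn y /(hom_lps (@gcosetM _ M))|GM].
  by rewrite Mn => /gcoset_eq1.
apply/lps_trivialP => u.
rewrite (lps_surj _ _ (@gcosetM _ M) (@gcoset_onto _ M)) => -[y /GM My <-].
exact/gcoset_eq1.
Qed.

(** The images of the free generators form a smallest generating family, since
   the quotient still surjects onto the space of coordinates. *)
Lemma quotient_min_generated M : M `<=` lps p G 2 ->
  min_generated_by (gquot M) d.
Proof.
have [_ Gx _] := xG => M2.
have [lam [lamM lamx lamP lamE]] := rel_free_coord p_pr n_gt0 xG.
have [mu muM muE] : exists2 mu : gquot M -> 'rV['F_p]_d, hom mu &
    forall y, mu (gcoset M y) = lam y.
  apply: (gquot_factor lamM) => y /M2 y2; rewrite -(hom1 lamM); apply/lamE.
  by rewrite gcoset1; apply/gcoset_eq1.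
split.
  apply/generated_byP; exists (gcoset M \o x) => [i j /= /(congr1 mu)|].
    rewrite !muE !lamx => /rowP/(_ j); rewrite !mxE !eqxx /=.
    by case: eqP => // ->.
  rewrite -(image_comp x); apply: gen_image Gx; first exact: gcosetM.
  exact: gcoset_onto.
move=> k /generated_byP[z _ Mz]; pose A := (\matrix_i mu (z i))%R.
suff: row_full A.
  by rewrite -col_leq_rank => /leq_trans->//; apply: rank_leq_row.
have muA u : (mu u <= A)%MS.
  have: [set: gquot M] u by []; rewrite -Mz; move: u; apply: gen_sub.
    split=> [|u v /= uA vA|u /= uA] /=.
    - by rewrite (hom1 muM) FinRing.zmod1gE sub0mx.
    - by rewrite muM FinRing.zmodMgE addmx_sub.
    - by rewrite (homV muM) FinRing.zmodVgE eqmx_opp.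
  by move=> _ [i _ <-] /=; apply: (eq_row_sub i); rewrite rowK.
rewrite -sub1mx; apply/row_subP => i.
by rewrite row1 -lamx -muE.
Qed.

(** If the kernel of f were not contained in the second term, one of the
   generators would be redundant, first modulo the second term and then, the
   second term consisting of non-generators, in H itself. *)
Lemma ker_min_generated (H : groupType) (f : G -> H) : hom f ->
    gen (range (f \o x)) = setT -> lps p H n.+1 = [set 1] :> set H ->
    (forall k, generated_by H k -> (d <= k)%N) -> injective (f \o x) ->
  forall y, f y = 1 -> nsub_set (lps p G 2) y.
Proof.
move=> fM Hx Hn Hmin fxI y fy1; apply: contrapT => yG2.
have [lam [lamM lamx lamP lamE]] := rel_free_coord p_pr n_gt0 xG.
have lamy : lam y <> 0%R.
  move=> y0; apply/yG2/gcoset_eq1; rewrite -gcoset1; apply/lamE.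
  by rewrite y0 (hom1 lamM).
have [j yj] : exists j, lam y ord0 j != 0%R.
  apply/existsP; apply: contra_notT lamy => /existsPn y0.
  by apply/rowP => j; rewrite mxE; apply/eqP/negPn/y0.
(* A power of y, still in the kernel, whose j-th coordinate is 1: it expresses
   the j-th generator through the others. *)
pose a : nat := ((lam y ord0 j)^-1)%R.
pose v := lam (y ^+ a).
have vj : v ord0 j = 1%R.
  rewrite /v (homX lamM) FinRing.zmodXgE mulmxnE -GRing.mulr_natr.
  by rewrite natr_Zp GRing.mulfV.
pose w := (v - 'e_j)%R.
have wj : w ord0 j = 0%R by rewrite !mxE vj !eqxx GRing.subrr.
pose K := gen (range (f \o x \o lift j)).
have KH : subgroup K by apply: gen_subgroup.
pose c := gcoset (lps p H 2); have cM : hom c by apply: gcosetM.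
have cKG : subgroup (c @` K) by apply: image_subgroup KH.
have [cK1 cKM cKV] := cKG.
have cKx i : i != j -> (c @` K) (c (f (x i))).
  move=> ij; exists (f (x i)) => //; apply: sub_gen.
  by case: (unliftP j i) ij => [i' -> _|->]; [exists i'|rewrite eqxx].
have zC i i' : commute ((c \o f \o x) i) ((c \o f \o x) i').
  exact: lps_central.
have zp i : (c \o f \o x) i ^+ p = 1 by apply: lps_expp.
have zM := exp_prodM p_pr zC zp.
have cKj : (c @` K) (c (f (x j))).
  have : exp_prod (c \o f \o x) v = 1.
    have cfM := hom_comp cM fM.
    rewrite -(@hom_exp_prod _ _ _ (c \o f) _ x v cfM) /=.
    have /gcoset_eq/(hom_lps fM) := lamP (y ^+ a); rewrite -/v.
    rewrite fM (homV fM) (homX fM) fy1 expg1n invg1 mul1g => /gcoset_eq1 //.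
  rewrite (_ : v = w * ('e_j)%R); last by rewrite FinRing.zmodMgE GRing.subrK.
  rewrite zM exp_prod_delta => /mulg1_eq e.
  rewrite -[c (f (x j))]/((c \o f \o x) j) -e; apply: cKV.
  rewrite /exp_prod; elim/big_rec: _ => // i u _ Ku; apply: cKM => //.
  have [->|ij] := eqVneq i j; first by rewrite wj.
  by apply: (subgroupX _ cKG); apply: cKx.
have KE : forall h, K h.
  apply: (lps_nongen KH Hn) => h; suff [k Kk kh] : (c @` K) (c h) by exists k.
  suff : gen (range (f \o x)) `<=` c @^-1` (c @` K) by rewrite Hx; apply.
  apply: gen_sub => [|_ [i _ <-]]; first exact: preimage_subgroup cM cKG.
  by have [->//|ij] := eqVneq i j; apply: cKx.
have /Hmin : generated_by H d.-1.
  apply/generated_byP; exists (f \o x \o lift j).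
    exact: inj_comp fxI lift_inj.
  by apply/seteqP; split=> // h _; apply: KE.
by rewrite leqNgt ltn_predL (leq_ltn_trans _ (ltn_ord j)).
Qed.

Lemma min_generated_quotient (H : groupType) :
    lps p H n.+1 = [set 1] :> set H -> min_generated_by H d ->
  exists2 M : nsubgroup G, M `<=` lps p G 2 & isomorphic (gquot M) H.
Proof.
have [_ _ xP] := xG => Hn [/generated_byP[z zI Hz] Hmin].
have [f fM fx] := xP H z Hn.
have zE : f \o x = z by apply/funext.
have fK : normal_subgroup [set y | f y = 1].
  split.
    by apply: (equalizer_subgroup fM (g := fun=> 1)) => u v; rewrite mulg1.
  by move=> y u /= fy; rewrite (homJ fM) fy conj1g.
exists (NSubgroup fK) => [y /=|].
  by apply: (@ker_min_generated _ f) => //; rewrite ?zE.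
have [||h hI _] := gquot_iso (N := NSubgroup fK) fM _ _; last by exists h.
  have fG : range f = setT.
    apply/seteqP; split=> //; rewrite -Hz; apply: gen_sub.
      exact: image_subgroup.
    by move=> _ [i _ <-]; exists (x i).
  by move=> u; have : [set: H] u by []; rewrite -fG => -[y _ <-]; exists y.
by [].
Qed.

(** Every element is killed by the n-th power of p, so by Cauchy's theorem p is
   the only prime divisor of the order. *)
Lemma quotient_pgroup M : exists gT : finGroupType,
  p.-group [set: gT]%G /\ isomorphic (gquot M) gT.
Proof.
have [|gT gMT] := @finite_group_iso (gquot M).
  apply: (@sub_finite_set _ _ (range (gcoset M))).
    by move=> u _; have [y <-] := gcoset_onto u; exists y.
  by apply: finite_image; apply: rel_free_finite n_gt0 xG.
exists gT; split=> //; apply/pgroupP => q q_pr /(Cauchy q_pr)[y _ yq].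
have := lps_expp_pow p y n.
rewrite (lps_trivial_iso gMT (quotient_lps M)) /= => /eqP.
rewrite -order_dvdn yq Euclid_dvdX// dvdn_prime2// => /andP[/eqP-> _].
by rewrite inE.
Qed.

End RelFreeQuotients.

(** * The action of GL(d, p) *)

Section LinearAction.
Context (p d n : nat) (p_pr : prime p) (n_gt0 : (1 <= n)%N).
Context (F : groupType) (x : 'I_d -> F) (xF : free_basis x).
Implicit Types M : nsubgroup (pquot p n F).

Let xG := pquot_rel_free p n xF.

Lemma gl_inducedE (f : pquot p n F -> pquot p n F) (g : 'M['F_p]_d) :
  gl_induced x f g = induces (pcoset p n \o x) f g.
Proof. by rewrite /gl_induced /induces -pterm_lps. Qed.

(** The choice in the definition of the action is harmless: automorphisms
   inducing the same matrix agree modulo the second term, hence on the n-th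
   term. *)
Lemma gl_actE (f : pquot p n F -> pquot p n F) (g : 'M['F_p]_d) y :
  aut f -> gl_induced x f g -> pterm p n F n y -> gl_act x g y = f y.
Proof.
move=> fA fg; rewrite pterm_lps => yn.
apply: xget_unique => [|_ [f' [f'A f'g ->]]]; first by exists f.
have [[fM _] [f'M _]] := (fA, f'A).
rewrite !gl_inducedE in fg f'g.
have {}yn : nsub_set (lps p (pquot p n F) n.-1.+1) y by rewrite prednK.
have := hom_lps_cong f'M fM (induces_cong p_pr n_gt0 xG f'M fM f'g fg) yn.
move/gcoset_eq; rewrite prednK// pquot_lps => /mulg1_eq.
by rewrite invgK.
Qed.

Lemma gl_act_image (f : pquot p n F -> pquot p n F) (g : 'M['F_p]_d) M :
  aut f -> gl_induced x f g -> calC p n F M -> gl_act x g @` M = f @` M.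
Proof.
move=> fA fg MC; apply: eq_imagel => y /MC; exact: gl_actE.
Qed.

Lemma gl_induced_ex (f : pquot p n F -> pquot p n F) : aut f ->
  exists2 g : 'M['F_p]_d, g \in unitmx & gl_induced x f g.
Proof.
move=> fA; have [g fg] := induces_ex p_pr n_gt0 xG f.
exists g; last by rewrite gl_inducedE.
by have [fM _] := fA; apply/(induces_aut p_pr n_gt0 xG fM fg).
Qed.

Lemma gl_induced_aut (g : 'M['F_p]_d) : g \in unitmx ->
  exists2 f : pquot p n F -> pquot p n F, aut f & gl_induced x f g.
Proof.
move=> gU; have [f fM fg] := induces_endo xG g.
exists f; last by rewrite gl_inducedE.
exact/(induces_aut p_pr n_gt0 xG fM fg).
Qed.

Lemma gl_orbitE M : calC p n F M -> gl_orbit x M = aut_orbit M.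
Proof.
move=> MC; apply/seteqP; split=> M' [].
  move=> g /gl_induced_aut[f fA fg] ME; exists f => //.
  by rewrite ME; apply: gl_act_image.
move=> f /[dup] fA /gl_induced_ex[g gU fg] ME; exists g => //.
by rewrite ME; apply/esym/gl_act_image.
Qed.

Lemma calC_calA : (2 <= n)%N -> calC p n F `<=` calA p n F.
Proof.
move=> n2 M MC y /MC; rewrite !pterm_lps; exact: lps_anti.
Qed.

Lemma calA_lps M : calA p n F M <-> M `<=` lps p (pquot p n F) 2.
Proof. by rewrite /calA /= pterm_lps. Qed.

(** An invertible matrix fixing M is induced by an automorphism preserving M,
   and it is the identity when that automorphism is trivial modulo the second
   term; [trivial_frattini_quotient] translates this into a property of the
   quotient. *)
Lemma gl_stabilizerP M : calC p n F M -> M `<=` lps p (pquot p n F) 2 ->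
  trivial_frattini_auts p (gquot M) <->
  forall g : 'M['F_p]_d, g \in unitmx ->
    gl_act x g @` M = M :> set (pquot p n F) -> g = 1%:M%R.
Proof.
move=> MC M2; have id1 := induces_id p_pr n_gt0 xG.
rewrite (trivial_frattini_quotient xG M2); split=> [tM g gU Mg|tM f fA ME].
  have [f fA fg] := gl_induced_aut gU.
  rewrite (gl_act_image fA fg MC) in Mg.
  rewrite gl_inducedE in fg.
  apply: (induces_inj p_pr n_gt0 xG) id1.
  by apply: cong_induces fg; apply: tM fA (esym Mg).
have [g gU fg] := gl_induced_ex fA.
have g1 : g = 1%:M%R by apply: tM => //; rewrite (gl_act_image fA fg MC).
have [fM _] := fA; rewrite g1 gl_inducedE in fg.
exact: (induces_cong p_pr n_gt0 xG fM (@hom_id _) fg id1).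
Qed.

Lemma preim_quotient M : isomorphic (gquot (nsub_preim M)) (gquot M).
Proof.
have [|||h hI _] := @gquot_iso _ (nsub_preim M) _ (gcoset M \o pcoset p n).
- by apply: hom_comp; apply: gcosetM.
- move=> u; have [y <-] := gcoset_onto u; have [z <-] := gcoset_onto y.
  by exists z.
- by move=> y; rewrite /= gcoset_eq1.
by exists h.
Qed.

End LinearAction.

(** * The map on orbits *)

(** Quantifying over the representatives of the orbit O defines the map on all
   sets without choosing one. *)
Definition quotient_class p n (F : groupType)
    (O : set (nsubgroup (pquot p n F))) : group_class :=
  fun H =>
    exists M, [/\ calA p n F M, O = aut_orbit M & isomorphic (gquot M) H].

Lemma pgroup_classes_iso p (P : groupType -> Prop) (G : groupType) :
    (forall H K, isomorphic H K -> P H -> P K) ->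
  pgroup_classes p P (iso_class G) <->
  P G /\ exists gT : finGroupType, p.-group [set: gT]%G /\ isomorphic G gT.
Proof.
move=> Piso; split=> [[gT [pT PT /iso_classP GT]]|[PG [gT [pT GT]]]].
  by split; [apply: Piso (isomorphic_sym GT) PT|exists gT].
by exists gT; split; [|exact: Piso GT PG|exact/iso_classP].
Qed.

Section Correspondence.
Context (p d n : nat) (p_pr : prime p) (d_gt0 : (0 < d)%N) (n_gt0 : (1 <= n)%N).
Context (F : groupType) (x : 'I_d -> F) (xF : free_basis x).
Implicit Types M : nsubgroup (pquot p n F).

Let xG := pquot_rel_free p n xF.

Lemma quotient_classE M : calA p n F M ->
  quotient_class (aut_orbit M) = iso_class (gquot M).
Proof.
move=> MA; apply/funext => H; apply/propext; split=> [[M' [M'A]]|MH].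
  move=> /(aut_orbit_isoP xG); rewrite -!calA_lps => /(_ MA M'A).
  exact: isomorphic_trans.
by exists M.
Qed.

Lemma quotient_class_inj M M' : calA p n F M -> calA p n F M' ->
  quotient_class (aut_orbit M) = quotient_class (aut_orbit M') ->
  aut_orbit M = aut_orbit M'.
Proof.
move=> MA M'A; rewrite !quotient_classE// => /iso_classP.
by move=> MM'; apply/(aut_orbit_isoP xG) => //; apply/calA_lps.
Qed.

Lemma quotient_neq1 M : calA p n F M -> exists u : gquot M, u <> 1.
Proof.
move=> /calA_lps/(quotient_min_generated p_pr n_gt0 xG)[_ Mmin].
apply: contrapT => M1.
have : generated_by (gquot M) 0.
  apply/generated_byP; exists (fun i : 'I_0 => 1); first by case.
  apply/seteqP; split=> // u _; rewrite (_ : u = 1); first exact: gen1.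
  by apply: contrapT => u1; apply: M1; exists u.
by move/Mmin; rewrite leqNgt d_gt0.
Qed.

Lemma quotient_lengthA M : calA p n F M ->
  lower_plength_le p (gquot M) n /\ min_generated_by (gquot M) d.
Proof.
move=> MA; split; first exact/lower_plength_leP/(quotient_lps xG)/quotient_neq1.
by apply: (quotient_min_generated p_pr n_gt0 xG); apply/calA_lps.
Qed.

Lemma quotient_lengthB M : calA p n F M ->
  calB p n F M <-> lower_plength p (gquot M) n.
Proof.
move=> MA; rewrite lower_plengthP quotient_lps_n -pterm_lps.
split=> [[_ ?]|[? _]]; split=> //; exact: (quotient_lps xG).
Qed.

Lemma plength_le_min_generated_quotient (H : groupType) :
    lower_plength_le p H n /\ min_generated_by H d ->
  exists2 M, calA p n F M & isomorphic (gquot M) H.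
Proof.
move=> [[m mn [_ Hn]] Hd].
have [M M2 MH] := min_generated_quotient p_pr n_gt0 xG (Hn n.+1 mn) Hd.
by exists M => //; apply/calA_lps.
Qed.

Lemma lower_plength_iso (H K : groupType) : isomorphic H K ->
  lower_plength p H n -> lower_plength p K n.
Proof.
move=> HK /lower_plengthP[Hn HS]; apply/lower_plengthP; split.
  by apply: contra_not Hn; apply/lps_trivial_iso/isomorphic_sym.
exact: lps_trivial_iso HK HS.
Qed.

Lemma lower_plength_le_iso (H K : groupType) : isomorphic H K ->
  lower_plength_le p H n -> lower_plength_le p K n.
Proof.
move=> HK [m mn [Hm Hi]]; exists m => //; split.
  by apply: contra_not Hm; apply/lps_trivial_iso/isomorphic_sym.
by move=> i /Hi; apply: lps_trivial_iso.
Qed.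

Lemma quotient_class_bijA : bij_between (frakA p n F)
  (pgroup_classes p (fun H => lower_plength_le p H n /\ min_generated_by H d))
  (@quotient_class p n F).
Proof.
have Piso (H K : groupType) : isomorphic H K ->
    lower_plength_le p H n /\ min_generated_by H d ->
    lower_plength_le p K n /\ min_generated_by K d.
  move=> HK [Hn Hd]; split; first exact: lower_plength_le_iso HK Hn.
  exact: min_generated_by_iso HK Hd.
split=> [_ [M MA <-]|_ _ [M MA <-] [M' M'A <-]|_ [gT [pT PT ->]]].
- rewrite quotient_classE//; apply/pgroup_classes_iso => //.
  split; [exact: quotient_lengthA|exact: (quotient_pgroup p_pr n_gt0 xG)].
- exact: quotient_class_inj.
- have [M MA MH] := plength_le_min_generated_quotient PT.
  exists (aut_orbit M); first by exists M.
  by rewrite quotient_classE//; apply/iso_classP.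
Qed.

Lemma quotient_class_bijB : bij_between (frakB p n F)
  (pgroup_classes p (fun H => lower_plength p H n /\ min_generated_by H d))
  (@quotient_class p n F).
Proof.
have BA M : calB p n F M -> calA p n F M by case.
split=> [_ [M MB <-]|_ _ [M MA <-] [M' M'A <-]|_ [gT [pT [Tn Td] ->]]].
- have MA := BA _ MB; rewrite quotient_classE//; apply/pgroup_classes_iso.
    move=> H K HK [Hn Hd]; split; first exact: lower_plength_iso HK Hn.
    exact: min_generated_by_iso HK Hd.
  split; last exact: (quotient_pgroup p_pr n_gt0 xG).
  by split; [apply/quotient_lengthB|have [] := quotient_lengthA MA].
- by apply: quotient_class_inj; apply: BA.
- have [|M MA MH] := @plength_le_min_generated_quotient gT.
    by split=> //; exists n.
  exists (aut_orbit M); last by rewrite quotient_classE//; apply/iso_classP.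
  exists M => //; apply/quotient_lengthB => //.
  exact: lower_plength_iso (isomorphic_sym MH) Tn.
Qed.

Lemma frakC_gl_orbits : frakC p n F = gl_orbits p n x.
Proof.
by apply/seteqP; split=> _ [M MC <-]; exists M => //;
  rewrite (gl_orbitE p_pr n_gt0 xF).
Qed.

Hypothesis n_gt1 : (2 <= n)%N.

Lemma calC_aut_orbit M M' : calC p n F M -> aut_orbit M M' -> calC p n F M'.
Proof.
move=> MC [f [fM _] ME] y; rewrite ME => -[z /MC zn <-].
by move: zn; rewrite pterm_lps; apply: hom_lps.
Qed.

(** All quotients along an orbit are isomorphic, so triviality of one stabilizer
   is triviality of all. *)
Lemma gl_regularP M : calC p n F M ->
  gl_regular x (aut_orbit M) <-> trivial_frattini_auts p (gquot M).
Proof.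
have CA := calC_calA (p := p) (F := F) n_gt1.
move=> MC; split=> [reg|tM M' MM' ].
  apply/(gl_stabilizerP p_pr n_gt0 xF) => //; first exact/calA_lps/CA.
  by move=> g; apply: reg; apply: aut_orbit_refl.
have M'C := calC_aut_orbit MC MM'.
apply/(gl_stabilizerP p_pr n_gt0 xF) => //; first exact/calA_lps/CA.
apply: trivial_frattini_auts_iso tM.
by apply/(aut_orbit_isoP xG); [exact/calA_lps/CA..|apply/aut_orbit_eq].
Qed.

Lemma quotient_class_bijD : bij_between (frakD p n x)
  (fun C => image_classes (@quotient_class p n F) (frakC p n F) C /\
            pgroup_classes p (trivial_frattini_auts p) C)
  (@quotient_class p n F).
Proof.
have CA := calC_calA (p := p) (F := F) n_gt1.
have tiso := @trivial_frattini_auts_iso p.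
rewrite /frakD -frakC_gl_orbits.
split=> [_ [[M MC <-] reg]|_ _ [[M MC <-] _] [[M' M'C <-] _]|
         C [[_ [M MC <-] <-] tC]].
- split; first by exists (aut_orbit M) => //; exists M.
  rewrite quotient_classE; last exact: CA.
  apply/pgroup_classes_iso => //; split; first exact/gl_regularP.
  exact: (quotient_pgroup p_pr n_gt0 xG).
- by apply: quotient_class_inj; apply: CA.
- exists (aut_orbit M) => //; split; first by exists M.
  rewrite quotient_classE in tC; last exact: CA.
  by apply/gl_regularP => //; case/(pgroup_classes_iso _ _ tiso): tC.
Qed.

End Correspondence.

Local Close Scope group_scope.

Theorem theorem1p2 (p d n : nat) (p_pr : prime p) (d_ge2 : 2 <= d)
    (n_ge2 : 2 <= n) (F : groupType) (x : 'I_d -> F) (xF : free_basis x) :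
  frakC p n F = gl_orbits p n x /\
  exists pi : set (nsubgroup (pquot p n F)) -> group_class,
    [/\ forall M, calA p n F M ->
          pi (aut_orbit M) = iso_class (gquot (nsub_preim M)) /\
          pgroup_classes p (fun=> True) (pi (aut_orbit M)),
        bij_between (frakA p n F)
          (pgroup_classes p
             (fun H => lower_plength_le p H n /\ min_generated_by H d)) pi,
        bij_between (frakB p n F)
          (pgroup_classes p
             (fun H => lower_plength p H n /\ min_generated_by H d)) pi
      & bij_between (frakD p n x)
          (fun C => image_classes pi (frakC p n F) C /\
                    pgroup_classes p (trivial_frattini_auts p) C) pi].
Proof.
have n_gt0 : 1 <= n by apply: ltnW.
have d_gt0 : 0 < d by apply: ltnW.
split; first exact: frakC_gl_orbits.
exists (@quotient_class p n F); split=> [M MA|||].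
- rewrite (quotient_classE xF)//; split.
    exact/iso_classP/isomorphic_sym/preim_quotient.
  apply/pgroup_classes_iso => //; split=> //.
  exact: (quotient_pgroup p_pr n_gt0 (pquot_rel_free p n xF)).
- exact: quotient_class_bijA.
- exact: quotient_class_bijB.
- exact: quotient_class_bijD.
Qed.
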